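(* For every integer $n \geq 1$ and every nonnegative integer $r$, $$\frac{1}{n!} \sum_{\lambda \vdash n} f_{\lambda}^2 \sum_{u \in \lambda} \prod_{i=1}^{r}(h_u^2 - i^2) = \frac{1}{2(r+1)^2} \binom{2r}{r}\binom{2r+2}{r+1} \prod_{j=0}^{r} (n-j).$$
   Context: The outer sum runs over all partitions $\lambda$ of $n$, identified with their Young diagrams (sets of cells $u=(i,j)$). $f_\lambda$ denotes the number of standard Young tableaux of shape $\lambda$. For a cell $u=(i,j)\in\lambda$, the hook length $h_u$ is $\lambda_i - j + \lambda'_j - i + 1$, i.e. the number of cells directly to the right of $u$, directly below $u$, plus one ($\lambda'$ is the conjugate partition). An empty product equals $1$. *)

(* Defs.v *)
From HB Require Import structures.
From mathcomp Require Import all_boot all_order all_algebra.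

Set Implicit Arguments.
Unset Strict Implicit.
Unset Printing Implicit Defensive.

Definition is_intpart (s : seq nat) : bool := sorted geq s && (0 \notin s).

Record intpart (n : nat) : Type := IntPart {
  parts :> seq nat;
  _ : is_intpart parts && (sumn parts == n)
}.

HB.instance Definition _ n := [isSub for @parts n].
HB.instance Definition _ n := [Countable of intpart n by <:].

(* Finiteness of [intpart n]: a partition of n has at most n parts, each at
   most n, so it embeds in the sequences of size at most n over 'I_n.+1. *)
Section IntPartFinite.

Variable n : nat.

Definition intpart_enc (la : intpart n) : n.-bseq 'I_n.+1 :=
  insub_bseq n [seq inord p | p <- la].

Definition intpart_dec (b : n.-bseq 'I_n.+1) : option (intpart n) :=
  insub [seq val p | p <- b].

Lemma intpart_encK : pcancel intpart_enc intpart_dec.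
Proof.
case=> s sP; have /andP[/andP[_ s0] /eqP sn] := sP.
have sz : size s <= n.
  rewrite -sn; elim: s s0 {sP sn} => //= p s IHs.
  rewrite inE negb_or eq_sym -lt0n => /andP[p_gt0 /IHs].
  by rewrite -add1n; apply: leq_add.
have le_n p : p \in s -> p < n.+1.
  rewrite ltnS -sn; elim: s {sP s0 sn sz} => //= q s IHs.
  rewrite inE => /predU1P[->|/IHs]; first exact: leq_addr.
  by move/leq_trans; apply; apply: leq_addl.
rewrite /intpart_dec /intpart_enc /insub_bseq /= insubdK; last first.
  by rewrite unfold_in /= size_map.
rewrite -map_comp map_id_in; last by move=> p /le_n lt_p /=; rewrite inordK.
by rewrite insubT; congr Some; apply: val_inj.
Qed.

End IntPartFinite.

HB.instance Definition _ n : isFinite (intpart n) :=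
  PCanIsFinite (@intpart_encK n).

(* Cells are 0-based: the cell (i, j) of the Young diagram in matrix
   coordinates is the pair (i - 1, j - 1), with j - 1 < la_i. *)
Definition cell (la : seq nat) : Type := {i : 'I_(size la) & 'I_(nth 0 la i)}.

Definition crow (la : seq nat) (u : cell la) : nat := tag u.
Definition ccol (la : seq nat) (u : cell la) : nat := tagged u.

(* The part of index j (from 0) of the conjugate partition. *)
Definition conj_part (la : seq nat) (j : nat) : nat := count (ltn j) la.

(* With 0-based coordinates, la_i - j and la'_j - i become the arm and leg
   below; both subtractions are exact when la is a partition. *)
Definition hook_length (la : seq nat) (u : cell la) : nat :=
  (nth 0 la (crow u) - (ccol u).+1) + (conj_part la (ccol u) - (crow u).+1) + 1.

(* Entries are 0, ..., |la| - 1 instead of 1, ..., |la|. *)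
Definition is_SYT (la : seq nat) (T : {ffun cell la -> 'I_(sumn la)}) : bool :=
  [&& [forall k, #|[set u | T u == k]| == 1],
      [forall u, forall v,
         (crow u == crow v) && (ccol u < ccol v) ==> (T u < T v)]
    & [forall u, forall v,
         (ccol u == ccol v) && (crow u < crow v) ==> (T u < T v)]].

Definition num_SYT (la : seq nat) : nat :=
  #|[set T : {ffun cell la -> 'I_(sumn la)} | is_SYT T]|.

(* Main.v *)
(* For even g, summing g over the hook lengths of a partition is expressed
   through contents: twice the sum is twice the sum of g over the contents plus
   the sum of the second difference of g over all differences of two contents.
   For g(x) = prod_(i = 1..r) (x^2 - i^2) this is a polynomial in the power sums
   p_a of the contents, of weight 2 r + 2 when p_a has weight a + 2.  Adding a
   cell of content c to a partition changes such a polynomial by a polynomial in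
   c of weight smaller by 2, and the moments of c under the transition
   probabilities f_(la + c) / ((n + 1) f_la) are polynomials in the p_a by
   Newton's identities for divided differences.  Hence the Plancherel average is
   a polynomial in n of degree at most r + 1.  It vanishes for n <= r, because
   all hook lengths are then at most r, and for n = r + 1 only the corner of a
   hook shape contributes, which gives the sum of C(r, b)^2 over b. *)

Require Import Defs.
From mathcomp Require Import all_boot all_order all_algebra.
From mathcomp Require Import ring zify.
Import Order.TTheory GRing.Theory Num.Theory.
Local Open Scope ring_scope.

(** * Divided differences *)

(** The common tool is the rational function with zeros [Y] and poles [X], one more pole than zeros:
    its residues give divided differences, and its expansion at infinity obeys Newton's identities.
    It is used twice, with poles at the end contents beta_i of the padded rows and at -(m + 1). The
    zeros beta_i + 1 handle removal of a cell and prove Frobenius' formula; the zeros beta_i - 1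
    handle addition and give the transition probabilities. The obstacle is that f_la, defined by
    counting, yields no ratio f_(la + c) / f_la. Frobenius' formula supplies it, and it makes sense
    on any m + 1 rows with an empty last row allowed, vanishing when an added cell breaks the shape;
    so sums may run over all rows instead of corners. The weight a + 2 of p_a is dictated by two
    facts. Adding a cell changes p_a by c^a, and the mean of c^a has weight a, because the power
    sums of the poles minus those of the zeros are content sums of second differences and so lose
    two degrees. Each step of n therefore costs exactly two units of weight. *)

Section DividedDifferences.

Variable F : fieldType.
Implicit Types (X Y : seq F) (g : F -> F) (x y : F).

Definition divdiff X g :=
  \sum_(x <- X) g x / \prod_(z <- X | z != x) (x - z).

Lemma eq_divdiff X g g' : (forall x, g x = g' x) -> divdiff X g = divdiff X g'.
Proof. by move=> e; apply: eq_bigr => x _; rewrite e. Qed.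

Lemma divdiff_cons x X g : uniq (x :: X) ->
  divdiff (x :: X) (fun z => (z - x) * g z) = divdiff X g.
Proof.
move=> /= /andP[xX uX]; rewrite /divdiff big_cons subrr mul0r mul0r add0r.
rewrite [LHS]big_seq [RHS]big_seq; apply: eq_bigr => z zX.
have zx : z != x by apply: contraNneq xX => <-.
rewrite big_cons eq_sym zx /= -mulf_div divff ?mul1r //.
by rewrite subr_eq0.
Qed.

Lemma divdiffD X g g' :
  divdiff X (fun z => g z + g' z) = divdiff X g + divdiff X g'.
Proof. by rewrite -big_split; apply: eq_bigr => z _; rewrite mulrDl. Qed.

Lemma divdiffZ X a g : divdiff X (fun z => a * g z) = a * divdiff X g.
Proof. by rewrite /divdiff mulr_sumr; apply: eq_bigr => z _; rewrite mulrA. Qed.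

(** For distinct nodes with [size X = (size Y).+1], this is the coefficient of t^a in the product of
    1 - y t over [Y] divided by the product of 1 - x t over [X]. *)
Definition ddmoment X Y a := divdiff X (fun z => z ^+ a * \prod_(y <- Y) (z - y)).

Lemma ddmoment_consX x X Y a : uniq (x :: X) ->
  ddmoment (x :: X) Y a.+1 = x * ddmoment (x :: X) Y a + ddmoment X Y a.
Proof.
move=> u; rewrite /ddmoment -[divdiff X _](divdiff_cons _ _ _ u) -divdiffZ -divdiffD.
by apply: eq_divdiff => z; rewrite exprS; ring.
Qed.

Lemma ddmoment_consY y X Y a :
  ddmoment X (y :: Y) a = ddmoment X Y a.+1 - y * ddmoment X Y a.
Proof.
rewrite /ddmoment -mulNr -divdiffZ -divdiffD.
by apply: eq_divdiff => z; rewrite big_cons exprS; ring.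
Qed.

Lemma ddmoment_perm X X' Y a : perm_eq X X' -> ddmoment X Y a = ddmoment X' Y a.
Proof.
move=> p; rewrite /ddmoment /divdiff (perm_big _ p) /=; apply: eq_bigr => x _.
by rewrite (perm_big _ p).
Qed.

Lemma ddmoment1 x a : ddmoment [:: x] [::] a = x ^+ a.
Proof. by rewrite /ddmoment /divdiff big_seq1 big_nil big_cons eqxx big_nil mulr1 divr1. Qed.

Lemma ddmoment_low n X a : uniq X -> size X = n.+1 ->
  (a <= n)%N -> ddmoment X [::] a = (a == n)%:R.
Proof.
elim: n X a => [|n IH] [|x X] a u //= [] sX.
  case: X sX u => // _ _; rewrite leqn0 => /eqP->; exact: ddmoment1.
case: X sX u => // x' X' [] sX u.
have u1 : uniq (x' :: X') by case/andP: u.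
have sX1 : size (x' :: X') = n.+1 by rewrite /= sX.
elim: a => [|a IHa] ha; last first.
  rewrite ddmoment_consX // IHa ?(IH _ _ u1 sX1) ?eqSS; [|lia|lia].
  have -> : (a == n.+1) = false by lia.
  by rewrite mulr0 add0r.
(* The recursions at x and at x' express the same first moment. *)
have u2 : uniq (x' :: x :: X').
  by move: u; rewrite /= !inE !negb_or eq_sym => /and3P[/andP[-> ->] -> ->].
have u3 : uniq (x :: X') by case/andP: u2.
have e1 := ddmoment_consX _ _ [::] 0 u.
have e2 := ddmoment_consX _ _ [::] 0 u2.
have p : perm_eq (x' :: x :: X') (x :: x' :: X').
  by rewrite (perm_catCA [:: x'] [:: x] X').
rewrite !(ddmoment_perm _ _ _ _ p) e1 in e2.
rewrite (IH (x' :: X')) // (IH (x :: X')) //= ?sX // in e2.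
move/addIr/eqP: e2; rewrite -subr_eq0 -mulrBl mulf_eq0 => /orP[|/eqP //].
by rewrite subr_eq0 => /eqP xx'; move: u; rewrite xx' /= inE eqxx.
Qed.

Lemma ddmoment0 X Y : uniq X -> size X = (size Y).+1 -> ddmoment X Y 0 = 1.
Proof.
(* The exponent [a] is generalized because [ddmoment_consY] trades a zero for a higher power;
   [a + size Y] stays within the range of [ddmoment_low]. *)
move=> uX; suff H a n : size X = n.+1 -> (a + size Y <= n)%N ->
    ddmoment X Y a = (a + size Y == n)%N%:R.
  by move=> sX; rewrite (H _ (size Y)) // add0n eqxx.
elim: Y a n => [|y Y IH] a n sX /= ha.
  by rewrite addn0 in ha *; apply: ddmoment_low.
rewrite ddmoment_consY (IH _ n) //; last by lia.
rewrite (IH _ n) //; last by lia.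
have -> : (a + size Y == n)%N = false by lia.
by rewrite mulr0 subr0 addnS addSn.
Qed.

Definition psumdiff X Y k := \sum_(x <- X) x ^+ k - \sum_(y <- Y) y ^+ k.

Lemma geometric_telescope (S : nat -> F) x a :
  \sum_(k < a.+1) x ^+ k.+1 * S (a - k)%N
  = x * S a + x * \sum_(k < a) x ^+ k.+1 * S (a.-1 - k)%N.
Proof.
rewrite big_ord_recl subn0 expr1 mulr_sumr; congr (_ + _).
apply: eq_bigr => k _; rewrite /= /bump /= add1n exprS mulrA.
by congr (_ * S _); lia.
Qed.

(* In generating functions: if S' (1 - x t) = S (1 - y t) and t S_t = B S, then
   t S'_t = B' S' with B' = B + x t / (1 - x t) - y t / (1 - y t). *)
Lemma newton_step (S S' B B' : nat -> F) x y :
  S' 0%N = S 0%N ->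
  (forall a, S' a.+1 - x * S' a = S a.+1 - y * S a) ->
  (forall k, B' k.+1 = B k.+1 + x ^+ k.+1 - y ^+ k.+1) ->
  (forall a, a.+1%:R * S a.+1 = \sum_(k < a.+1) B k.+1 * S (a - k)%N) ->
  forall a, a.+1%:R * S' a.+1 = \sum_(k < a.+1) B' k.+1 * S' (a - k)%N.
Proof.
move=> e0 eS eB nS.
have nS0 a : a%:R * S a = \sum_(k < a) B k.+1 * S (a.-1 - k)%N.
  by case: a => [|a]; rewrite ?big_ord0 ?mul0r // nS.
suff H a : a%:R * S' a = \sum_(k < a) B' k.+1 * S' (a.-1 - k)%N.
  by move=> a; exact: H a.+1.
elim: a => [|a IHa]; first by rewrite big_ord0 mul0r.
(* Coefficientwise, B' S' (1 - x t) = B' S (1 - y t). *)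
have key : \sum_(k < a.+1) B' k.+1 * S' (a - k)%N
         - x * \sum_(k < a) B' k.+1 * S' (a.-1 - k)%N
         = \sum_(k < a.+1) B' k.+1 * S (a - k)%N
         - y * \sum_(k < a) B' k.+1 * S (a.-1 - k)%N.
  rewrite !big_ord_recr /= subnn e0 !mulr_sumr.
  rewrite addrAC [RHS]addrAC -!sumrB; congr (_ + _).
  apply: eq_bigr => k _; have ka := ltn_ord k.
  have -> : (a - k)%N = (a.-1 - k).+1 by lia.
  by rewrite !(mulrCA _ (B' _)) -!mulrBr eS.
have split (T : nat -> F) m b :
    \sum_(k < m) B' k.+1 * T (b - k)%N = \sum_(k < m) B k.+1 * T (b - k)%N
     + \sum_(k < m) x ^+ k.+1 * T (b - k)%N - \sum_(k < m) y ^+ k.+1 * T (b - k)%N.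
  by rewrite -big_split -sumrB; apply: eq_bigr => k _; rewrite eB /=; ring.
(* Since S (1 - y t) = S' (1 - x t), multiplying by the geometric series x t / (1 - x t) leaves x t
   S'. *)
have keyS : \sum_(k < a.+1) x ^+ k.+1 * S (a - k)%N
    - y * \sum_(k < a) x ^+ k.+1 * S (a.-1 - k)%N = x * S' a.
  have: \sum_(k < a.+1) x ^+ k.+1 * S' (a - k)%N
      - x * \sum_(k < a) x ^+ k.+1 * S' (a.-1 - k)%N = x * S' a.
    by rewrite geometric_telescope addrK.
  move=> <-; rewrite !big_ord_recr /= subnn e0 !mulr_sumr.
  rewrite addrAC [RHS]addrAC -!sumrB; congr (_ + _).
  apply: eq_bigr => k _; have ka := ltn_ord k.
  have -> : (a - k)%N = (a.-1 - k).+1 by lia.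
  by rewrite !(mulrCA _ (_ ^+ _)) -!mulrBr eS.
move: key; rewrite -IHa [X in _ = X - _]split [X in _ = _ - y * X]split -nS -nS0.
have := geometric_telescope S y a; move: keyS.
set s1 := \sum_(k < a.+1) _; set s2 := \sum_(k < a) _.
set s3 := \sum_(k < a.+1) _; set s4 := \sum_(k < a) _.
set s5 := \sum_(k < a.+1) _ => e1 e2 e3.
have -> : s5 = x * (a%:R * S' a) + (s5 - x * (a%:R * S' a)) by ring.
have -> : s5 - x * (a%:R * S' a) = a.+1%:R * (S a.+1 - y * S a) + x * S' a.
  by rewrite e3 -e1 e2 -natr1; ring.
by rewrite -eS -natr1; ring.
Qed.

(** [psumdiff] collects the coefficients of t times the logarithmic derivative of the generating
    function of [ddmoment]. The induction removes one pole and one zero at a time, down to a single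
    pole with moments x^a. *)
Lemma ddmoment_newton X Y : uniq X -> size X = (size Y).+1 -> forall a,
  a.+1%:R * ddmoment X Y a.+1
  = \sum_(k < a.+1) psumdiff X Y k.+1 * ddmoment X Y (a - k).
Proof.
elim: Y X => [|y Y IH] [|x X] //= u [] sX.
  case: X sX u => // _ _ a.
  rewrite (eq_bigr (fun=> x ^+ a.+1)); last first.
    move=> k _; rewrite /psumdiff big_seq1 big_nil subr0 !ddmoment1 -exprD.
    by congr (_ ^+ _); have := ltn_ord k; lia.
  by rewrite sumr_const card_ord ddmoment1 mulr_natl.
have uX : uniq X by case/andP: u.
apply: (newton_step (ddmoment X Y) _ (psumdiff X Y) _ x y) => [|a|k|].
- by rewrite !ddmoment0 //= sX.
- by rewrite ddmoment_consX // [ddmoment X _ a]ddmoment_consY; ring.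
- by rewrite /psumdiff !big_cons; ring.
- exact: IH.
Qed.

End DividedDifferences.

(** * Branching of standard Young tableaux *)

Lemma cell_inj (la : seq nat) (u v : cell la) :
  crow u = crow v -> ccol u = ccol v -> u = v.
Proof.
case: u v => [i j] [i' j']; rewrite /crow /ccol /= => /val_inj e.
by case: i' / e j' => j' /val_inj ->.
Qed.

Lemma crow_lt (la : seq nat) (u : cell la) : (crow u < size la)%N.
Proof. exact: ltn_ord. Qed.

Lemma ccol_lt (la : seq nat) (u : cell la) : (ccol u < nth 0 la (crow u))%N.
Proof. exact: ltn_ord. Qed.

Lemma cell_ex (la : seq nat) i j : (j < nth 0 la i)%N ->
  exists u : cell la, crow u = i /\ ccol u = j.
Proof.
move=> hj; have hi : (i < size la)%N.
  by rewrite ltnNge; apply: contraTN hj => hi; rewrite nth_default.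
by exists (Tagged (fun i : 'I_(size la) => 'I_(nth 0%N la i))
  (Ordinal hj : 'I_(nth 0%N la (Ordinal hi)))).
Qed.

Lemma sum_cells (la : seq nat) (R : nmodType) (g : nat -> nat -> R) :
  \sum_(u : cell la) g (crow u) (ccol u)
  = \sum_(i < size la) \sum_(j < nth 0%N la i) g i j.
Proof.
by rewrite sig_big_dep.
Qed.

Lemma card_cell (la : seq nat) : #|{: cell la}| = sumn la.
Proof.
rewrite card_tagged; congr (sumn _).
apply: (@eq_from_nth _ 0%N); rewrite size_map -cardE card_ord // => i hi.
by rewrite (nth_map (Ordinal hi)) -?cardE ?card_ord // nth_enum_ord.
Qed.

Lemma partP (la : seq nat) : reflect
  ((forall i, nth 0 la i.+1 <= nth 0 la i)%N /\
   (forall i, i < size la -> 0 < nth 0 la i)%N) (is_intpart la).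
Proof.
apply: (iffP andP) => -[h1 h2]; split.
- move=> i; case: (ltnP i.+1 (size la)) => hi; last by rewrite nth_default.
  exact: (sortedP 0%N h1).
- by move=> i hi; rewrite lt0n; apply: contraNneq h2 => <-; apply: mem_nth.
- by apply/(sortedP 0%N) => i _; apply: h1.
- by apply/(nthP 0%N) => -[i /h2 hi e]; rewrite e in hi.
Qed.

Lemma part_le (la : seq nat) i j :
  is_intpart la -> (i <= j)%N -> (nth 0 la j <= nth 0 la i)%N.
Proof.
move=> /partP[h _] /subnK <-; elim: (j - i)%N => // k IH.
exact: leq_trans (h _) IH.
Qed.

Lemma seq_nth_pos_eq (s t : seq nat) :
  (forall i, i < size s -> 0 < nth 0 s i)%N ->
  (forall i, i < size t -> 0 < nth 0 t i)%N ->
  (forall i, nth 0 s i = nth 0 t i)%N -> s = t.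
Proof.
move=> ps pt e; have sz : size s = size t.
  apply/eqP; rewrite eqn_leq; apply/andP; split; rewrite leqNgt; apply/negP.
  - by move=> /ps; rewrite e nth_default.
  - by move=> /pt; rewrite -e nth_default.
exact: (@eq_from_nth _ 0%N).
Qed.

Lemma size_le_sumn (s : seq nat) : 0%N \notin s -> (size s <= sumn s)%N.
Proof.
elim: s => //= p s IHs.
by rewrite inE negb_or eq_sym -lt0n => /andP[hp /IHs]; lia.
Qed.

Lemma size_part_le (la : seq nat) : is_intpart la -> (size la <= sumn la)%N.
Proof. by move=> /andP[_ /size_le_sumn]. Qed.

(** The bound [m] is kept apart from [sumn la] so that tableaux of a shape and of the shape with one
    more cell have codomains ['I_m] and ['I_m.+1] without casts. *)
Definition is_tab m (la : seq nat) (T : {ffun cell la -> 'I_m}) : bool :=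
  [&& injectiveb T,
      [forall u, forall v,
         (crow u == crow v) && (ccol u < ccol v)%N ==> (T u < T v)%N]
    & [forall u, forall v,
         (ccol u == ccol v) && (crow u < crow v)%N ==> (T u < T v)%N]].

Lemma is_tabP m (la : seq nat) (T : {ffun cell la -> 'I_m}) : reflect
  [/\ injective T,
      forall u v, crow u = crow v -> (ccol u < ccol v)%N -> (T u < T v)%N
    & forall u v, ccol u = ccol v -> (crow u < crow v)%N -> (T u < T v)%N]
  (is_tab m la T).
Proof.
apply: (iffP and3P) => -[h1 h2 h3]; split.
- exact/injectiveP.
- by move=> u v e l; move/forallP/(_ u)/forallP/(_ v): h2; rewrite e eqxx l.
- by move=> u v e l; move/forallP/(_ u)/forallP/(_ v): h3; rewrite e eqxx l.
- exact/injectiveP.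
- by apply/forallP => u; apply/forallP => v; apply/implyP => /andP[/eqP]; apply: h2.
- by apply/forallP => u; apply/forallP => v; apply/implyP => /andP[/eqP]; apply: h3.
Qed.

Lemma is_SYT_tab (la : seq nat) (T : {ffun cell la -> 'I_(sumn la)}) :
  is_SYT T = is_tab _ _ T.
Proof.
rewrite /is_SYT /is_tab; congr (_ && _).
apply/forallP/injectiveP => [h u v e | inj k].
  have /cards1P[w hw] := h (T v).
  have: v \in [set u | T u == T v] by rewrite inE.
  have: u \in [set u | T u == T v] by rewrite inE e.
  by rewrite hw !inE => /eqP-> /eqP->.
have [u hu] : exists u, T u = k.
  have := inj_card_onto inj; rewrite card_cell card_ord => /(_ (leqnn _) k).
  by case/codomP => u ->; exists u.
by apply/cards1P; exists u; apply/setP => v; rewrite !inE -hu (inj_eq inj).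
Qed.

Lemma num_SYT_tab (la : seq nat) m : sumn la = m ->
  num_SYT la = #|[set T : {ffun cell la -> 'I_m} | is_tab m la T]|.
Proof.
move=> <-; rewrite /num_SYT; apply: eq_card => T.
by rewrite !inE is_SYT_tab.
Qed.

Section AddCell.

Variables (la : seq nat) (i : nat).
Hypothesis la_part : is_intpart la.
Let La := incr_nth la i.

Let nthLa j : nth 0%N La j = ((i == j) + nth 0 la j)%N.
Proof. by rewrite nth_incr_nth. Qed.

(** The two cell types are unrelated dependent types, so the inclusion of diagrams is obtained as a
    function that preserves coordinates. *)
Lemma cell_incr_ex : exists e : cell la -> cell La,
  forall v, crow (e v) = crow v /\ ccol (e v) = ccol v.
Proof.
have H v : exists w : cell La, crow w = crow v /\ ccol w = ccol (v : cell la).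
  by apply: cell_ex; rewrite nthLa; apply: leq_trans (ccol_lt _ v) (leq_addl _ _).
by have [e he] := fin_all_exists H; exists e.
Qed.

Lemma cell_incr_cases (e : cell la -> cell La) :
  (forall v, crow (e v) = crow v /\ ccol (e v) = ccol v) ->
  forall u, (exists v, u = e v) \/ crow u = i /\ ccol u = nth 0%N la i.
Proof.
move=> he u; have := ccol_lt _ u; rewrite nthLa => hu.
case: (ltnP (ccol u) (nth 0%N la (crow u))) => [/cell_ex[v [e1 e2]] | le].
  by left; exists v; apply: cell_inj; rewrite ?(he v).1 ?(he v).2.
case: eqP hu => [-> hu|_]; last by rewrite add0n ltnNge le.
by right; split=> //; lia.
Qed.

(** The bijection erases the largest entry, which sits at the end of row [i] because rows increase,
    and inversely writes [ord_max] there. As [la] is a partition, no cell lies below the new one, so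
    the columns still increase. *)
Lemma card_tab_incr m :
  #|[set T : {ffun cell La -> 'I_m.+1} | is_tab _ _ T &
       [exists u, (T u == ord_max) && (crow u == i)]]|
  = #|[set T : {ffun cell la -> 'I_m} | is_tab _ _ T]|.
Proof.
have [e he] := cell_incr_ex; have cases := cell_incr_cases e he.
have e_inj : injective e.
  by move=> v w evw; apply: cell_inj; rewrite -?(he _).1 -?(he _).2 evw.
have [top [top1 top2]] : exists u : cell La, crow u = i /\ ccol u = nth 0%N la i.
  by apply: cell_ex; rewrite nthLa eqxx.
have top_e v : e v != top.
  apply/eqP => ev; have := ccol_lt _ v.
  by rewrite -(he v).1 -(he v).2 ev top1 top2 ltnn.
have casesT u : (exists v, u = e v) \/ u = top.
  by case: (cases u) => [|[h1 h2]]; [left | right; apply: cell_inj; rewrite ?top1 ?top2].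
pose ext (T : {ffun cell la -> 'I_m}) : {ffun cell La -> 'I_m.+1} :=
  [ffun u => if [pick v | e v == u] is Some v then lift ord_max (T v) else ord_max].
have ext_e T v : ext T (e v) = lift ord_max (T v).
  rewrite ffunE; case: pickP => [w /eqP/e_inj -> //|/(_ v)]; by rewrite eqxx.
have ext_top T : ext T top = ord_max.
  by rewrite ffunE; case: pickP => // w; rewrite (negPf (top_e w)).
have lift_lt (a b : 'I_m) : (lift ord_max a < lift ord_max b)%N = (a < b)%N.
  by rewrite !lift_max.
have ext_inj : injective ext.
  move=> T T' E; apply/ffunP => v; have := ext_e T v.
  by rewrite E ext_e => /lift_inj ->.
rewrite -(card_imset _ ext_inj); apply: eq_card => T; rewrite inE.
apply/andP/imsetP => [[/is_tabP[inj rows cols] /existsP[u /andP[/eqP Tu /eqP ui]]] | [T' ]].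
  have Ttop : T top = ord_max.
    case: (casesT u) => [[v uv]|<- //].
    have /rows : crow u = crow top by rewrite ui.
    rewrite Tu top2 uv (he v).2; have := ccol_lt _ v.
    rewrite -(he v).1 -uv ui => h /(_ h) /=.
    by rewrite ltnNge -ltnS ltn_ord.
  have /fin_all_exists[T' hT'] v : exists k : 'I_m, lift ord_max k = T (e v).
    case: (unliftP ord_max (T (e v))) => [k -> | ]; first by exists k.
    by rewrite -Ttop => /inj/eqP; rewrite (negPf (top_e v)).
  have TT : T = ext (finfun T').
    apply/ffunP => w; case: (casesT w) => [[v ->]| ->]; last by rewrite ext_top.
    by rewrite ext_e ffunE hT'.
  exists (finfun T') => //; rewrite inE; apply/is_tabP; split=> [v w|v w|v w].
  - rewrite !ffunE => E; apply: e_inj; apply: inj.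
    by rewrite -!hT' E.
  - rewrite -lift_lt !ffunE !hT' => h1 h2; apply: rows; first by rewrite !(he _).1.
    by rewrite !(he _).2.
  - rewrite -lift_lt !ffunE !hT' => h1 h2; apply: cols; first by rewrite !(he _).2.
    by rewrite !(he _).1.
rewrite inE => /is_tabP[inj rows cols] ->.
have lt_top v : (ext T' (e v) < ext T' top)%N.
  by rewrite ext_e ext_top lift_max.
split; last by apply/existsP; exists top; rewrite ext_top top1 !eqxx.
apply/is_tabP; split=> u w.
- case: (casesT u) => [[v ->]| ->]; case: (casesT w) => [[v' ->]| ->] //.
  + by rewrite !ext_e => /lift_inj/inj ->.
  + by move=> E; have := lt_top v; rewrite E ltnn.
  + by move=> E; have := lt_top v'; rewrite E ltnn.
- case: (casesT u) => [[v ->]| ->]; case: (casesT w) => [[v' ->]| ->] //.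
  + by rewrite !(he _).1 !(he _).2 !ext_e lift_lt; apply: rows.
  + rewrite (he _).1 (he _).2 top1 top2 => E; have := ccol_lt _ v'.
    by rewrite -E; lia.
  + by move=> _; rewrite ltnn.
- case: (casesT u) => [[v ->]| ->]; case: (casesT w) => [[v' ->]| ->] //.
  + by rewrite !(he _).1 !(he _).2 !ext_e lift_lt; apply: cols.
  + rewrite (he _).1 (he _).2 top1 top2 => E /ltnW; have := ccol_lt _ v'.
    rewrite -E => h1 h2; have := part_le _ _ _ la_part h2; lia.
  + by move=> _; rewrite ltnn.
Qed.

End AddCell.

(** A part equal to 1 is cut off rather than lowered, since a partition contains no 0; when row [i]
    is removable such a part is the last one. *)
Definition decr_part (la : seq nat) i :=
  if nth 0%N la i == 1%N then take i la else set_nth 0%N la i (nth 0%N la i).-1.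

(** The default 0 of [nth] makes the last row of a partition removable and excludes every row beyond
    it. *)
Definition removable (la : seq nat) i := (nth 0 la i.+1 < nth 0 la i)%N.

Lemma nth_decr_part (la : seq nat) i j : is_intpart la -> removable la i ->
  nth 0%N (decr_part la i) j = (nth 0 la j - (i == j))%N.
Proof.
move=> pla; rewrite /removable /decr_part => rem.
case: eqP => h; last by rewrite nth_set_nth /= [j == i]eq_sym; case: eqP => [->|_]; lia.
case: (ltnP j i) => ij; first by rewrite nth_take // (gtn_eqF ij) subn0.
rewrite nth_default ?size_take; last by case: ifP; lia.
case: eqP => [<-|ne]; first by rewrite h.
have /(part_le _ _ _ pla) : (i.+1 <= j)%N by lia.
lia.
Qed.

Lemma size_decr_part (la : seq nat) i :
  removable la i -> (size (decr_part la i) <= size la)%N.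
Proof.
rewrite /removable /decr_part => rem.
have hi : (i < size la)%N.
  by rewrite ltnNge; apply: contraTN rem => h; rewrite [nth _ _ i]nth_default.
case: ifP => _; first by rewrite size_take hi ltnW.
by rewrite size_set_nth (maxn_idPr hi).
Qed.

Lemma decr_part_is_part (la : seq nat) i :
  is_intpart la -> removable la i -> is_intpart (decr_part la i).
Proof.
move=> pla rem; apply/partP; split=> [j|j hj].
  rewrite !nth_decr_part //; have /partP[/(_ j) h _] := pla.
  move: rem; rewrite /removable; case: eqP => [->|_]; case: eqP => [->|_]; lia.
have hj' := leq_trans hj (size_decr_part _ _ rem).
rewrite nth_decr_part //; have /partP[_ /(_ j hj')] := pla.
case: eqP => [ij|]; last by lia.
move: hj; rewrite -ij /decr_part; case: eqP => h; last by lia.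
by rewrite size_take; case: ifP; lia.
Qed.

Lemma incr_decr_part (la : seq nat) i :
  is_intpart la -> removable la i -> incr_nth (decr_part la i) i = la.
Proof.
move=> pla rem.
have hi : (i < size la)%N.
  by rewrite ltnNge; apply: contraTN rem => h; rewrite /removable [nth _ _ i]nth_default.
have sz : size (incr_nth (decr_part la i) i) = size la.
  rewrite size_incr_nth; move: rem; rewrite /removable /decr_part.
  case: eqP => h rem; last by rewrite size_set_nth (maxn_idPr hi) hi.
  rewrite size_take hi ltnn; apply/eqP; rewrite eqn_leq hi leqNgt; apply/negP.
  have /partP[_ /[apply]] := pla; lia.
apply: (@eq_from_nth _ 0%N) => // j hj; rewrite nth_incr_nth nth_decr_part //.
move: rem; rewrite /removable; case: eqP => [->|_]; lia.
Qed.

Lemma incr_part_inj i : {in is_intpart &, injective (fun la => incr_nth la i)}.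
Proof.
move=> la la' /partP[_ p] /partP[_ p'] /= e; apply: seq_nth_pos_eq => // j.
by have := congr1 (fun s => nth 0%N s j) e; rewrite !nth_incr_nth => /addnI.
Qed.

Lemma removable_incr (la : seq nat) i : is_intpart la -> removable (incr_nth la i) i.
Proof.
move=> /partP[/(_ i) h _]; rewrite /removable !nth_incr_nth eqxx.
by have -> : (i == i.+1) = false by lia.
Qed.

Lemma sumn_incr_nth (s : seq nat) i : sumn (incr_nth s i) = (sumn s).+1.
Proof.
elim: s i => [|p s IH] [|i] //=; first by rewrite sumn_ncons /= mul0n add0n.
by rewrite IH addnS.
Qed.

(** Tableaux are sorted by the row of their largest entry. Its cell is a corner, since a cell below
    it would need a still larger entry. *)
Lemma num_SYT_branch (la : seq nat) n : is_intpart la -> sumn la = n.+1 ->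
  num_SYT la = (\sum_(i < n.+1 | removable la i) num_SYT (decr_part la i))%N.
Proof.
move=> pla sla; rewrite (num_SYT_tab _ _ sla) -sum1_card.
(* The default [ord0] is never reached on a tableau: injectivity and [sumn la = n.+1] force the
   entry [ord_max] to occur. *)
pose q (T : {ffun cell la -> 'I_n.+1}) : 'I_n.+1 :=
  if [pick u | T u == ord_max] is Some u then inord (crow u) else ord0.
have row_lt (u : cell la) : (crow u < n.+1)%N.
  by apply: leq_trans (crow_lt _ u) _; rewrite -sla; apply: size_part_le.
have topP (T : {ffun cell la -> 'I_n.+1}) : is_tab _ _ T ->
    exists2 u, T u = ord_max & q T = crow u :> nat.
  move=> /is_tabP[inj _ _].
  have [u hu] : exists u, T u = ord_max.
    have := inj_card_onto inj; rewrite card_cell card_ord sla => /(_ (leqnn _) ord_max).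
    by case/codomP => u ->; exists u.
  exists u => //; rewrite /q; case: pickP => [v /eqP hv|/(_ u)]; last by rewrite hu eqxx.
  have -> : v = u by apply: inj; rewrite hu.
  by rewrite inordK.
have remP (T : {ffun cell la -> 'I_n.+1}) : is_tab _ _ T -> removable la (q T).
  move=> tT; have [u hu ->] := topP _ tT; have /is_tabP[_ _ cols] := tT.
  rewrite /removable; apply: leq_trans (ccol_lt _ u).
  rewrite ltnS leqNgt; apply/negP => /cell_ex[v [v1 v2]].
  have := cols u v; rewrite v1 v2 hu => /(_ erefl (leqnn _)) /=.
  by rewrite ltnNge -ltnS ltn_ord.
rewrite (partition_big q (fun i => removable la i)); last by move=> T; rewrite inE; apply: remP.
apply: eq_bigr => i rem /=.
have pd := decr_part_is_part _ _ pla rem.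
have sd : sumn (decr_part la i) = n.
  by have := congr1 sumn (incr_decr_part _ _ pla rem); rewrite sumn_incr_nth sla => -[].
rewrite (num_SYT_tab _ _ sd) -(card_tab_incr _ i pd) incr_decr_part // sum1_card.
apply: eq_card => T; rewrite unfold_in /= !inE.
case tT: (is_tab _ _ T) => //=; apply/eqP/existsP => [<-|[u /andP[/eqP hu /eqP ui]]].
  by have [u hu qu] := topP _ tT; exists u; rewrite hu qu !eqxx.
have [v hv qv] := topP _ tT; apply/val_inj; rewrite /= qv -ui.
by have /is_tabP[inj _ _] := tT; congr crow; apply: inj; rewrite hu.
Qed.

(** * Frobenius formula and transition moments *)

Definition vdm (N : nat) (y : nat -> rat) : rat :=
  \prod_(j < N) \prod_(k < N | (j < k)%N) (y j - y k).

Lemma vdm_split N y (i : 'I_N) :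
  vdm N y = \prod_(k < N | (k < i)%N) (-1) * \prod_(k < N | k != i) (y i - y k)
    * \prod_(j < N | j != i) \prod_(k < N | (j < k)%N && (k != i)) (y j - y k).
Proof.
rewrite /vdm (bigD1 i) //=.
have inner (j : 'I_N) : j != i ->
    \prod_(k < N | (j < k)%N) (y j - y k) = (if (j < i)%N then y j - y i else 1)
      * \prod_(k < N | (j < k)%N && (k != i)) (y j - y k).
  move=> ji; case: ifP => h; first by rewrite (bigD1 i).
  rewrite mul1r; apply: eq_bigl => k; case: eqP => [->|]; last by rewrite andbT.
  by rewrite h.
rewrite (eq_bigr _ inner) big_split /= -big_mkcondr /= mulrA; congr (_ * _).
rewrite [\prod_(k < N | k != i) _](bigID (fun k : 'I_N => (k < i)%N)) /=.
have P1 (k : 'I_N) : (k != i) && (k < i)%N = (k < i)%N by rewrite -val_eqE /=; lia.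
rewrite !(eq_bigl _ _ P1) /=.
rewrite mulrA -big_split /= mulrC; congr (_ * _).
  by apply: eq_bigr => k _; ring.
by apply: eq_bigl => k; rewrite -val_eqE /=; lia.
Qed.

(** The sign in [vdm_split] depends only on [i], and the factors without index [i] agree, so both
    cancel. The cross-multiplied form stays valid when [y] has repeated values. *)
Lemma vdm_update N (y y' : nat -> rat) (i : 'I_N) :
  (forall j : 'I_N, j != i -> y' j = y j) ->
  vdm N y' * \prod_(k < N | k != i) (y i - y k)
  = vdm N y * \prod_(k < N | k != i) (y' i - y k).
Proof.
move=> e; rewrite !(vdm_split _ _ i).
have -> : \prod_(k < N | k != i) (y' i - y' k) = \prod_(k < N | k != i) (y' i - y k).
  by apply: eq_bigr => k /e ->.
have -> : \prod_(j < N | j != i) \prod_(k < N | (j < k)%N && (k != i)) (y' j - y' k)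
        = \prod_(j < N | j != i) \prod_(k < N | (j < k)%N && (k != i)) (y j - y k).
  by apply: eq_bigr => j /e ->; apply: eq_bigr => k /andP[_ /e ->].
ring.
Qed.

(* The content of the cell that would be added at the end of row j. *)
Definition beta (la : seq nat) (j : nat) : rat := (nth 0%N la j)%:R - j%:R.

Lemma beta_incr la i j : beta (incr_nth la i) j = beta la j + (i == j)%:R.
Proof. by rewrite /beta nth_incr_nth natrD; ring. Qed.

Lemma beta_lt (la : seq nat) j k :
  is_intpart la -> (j < k)%N -> beta la k < beta la j.
Proof.
move=> pla jk; have := part_le _ _ _ pla (ltnW jk); rewrite /beta => h.
by apply: ler_ltB; rewrite ?ler_nat ?ltr_nat.
Qed.

Lemma beta_eq (la : seq nat) j k :
  is_intpart la -> (beta la j == beta la k) = (j == k).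
Proof.
move=> pla; case: (ltngtP j k) => [h|h|->]; last by rewrite eqxx.
- by rewrite gt_eqF // beta_lt.
- by rewrite lt_eqF // beta_lt.
Qed.

Lemma beta_gt (la : seq nat) j N : (j < N)%N -> - N%:R < beta la j.
Proof.
move=> jN; rewrite /beta -subr_gt0 opprK.
have -> : (nth 0%N la j)%:R - j%:R + N%:R = (nth 0%N la j + (N - j))%N%:R :> rat.
  by rewrite natrD natrB ?(ltnW jN) //; ring.
by rewrite ltr0n; lia.
Qed.

(* Frobenius' form of the hook length formula, over m.+1 >= size la rows. *)
Definition frob (m : nat) (la : seq nat) : rat :=
  (sumn la)`!%:R * vdm m.+1 (beta la)
  / \prod_(j < m.+1) ((nth 0 la j + (m - j))`!)%N%:R.

(** The ratio f_(la + i) / f_la: one Vandermonde variable moves by 1, and one factorial gains the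
    factor beta_i + m + 1. Without division it can be read upwards, downwards, and for rows where
    the new cell breaks the shape. *)
Lemma frob_incr m la (i : 'I_m.+1) :
  frob m (incr_nth la i) * (beta la i + m.+1%:R)
    * \prod_(k < m.+1 | k != i) (beta la i - beta la k)
  = frob m la * (sumn la).+1%:R
    * \prod_(k < m.+1 | k != i) (beta la i + 1 - beta la k).
Proof.
have upd : forall j : 'I_m.+1, j != i -> beta (incr_nth la i) j = beta la j.
  by move=> j ji; rewrite beta_incr eq_sym -val_eqE in ji *; rewrite (negPf ji) addr0.
have := vdm_update _ (beta la) (beta (incr_nth la i)) i upd.
rewrite beta_incr eqxx => /= e.
have den : \prod_(j < m.+1) ((nth 0 (incr_nth la i) j + (m - j))`!)%N%:R
  = (beta la i + m.+1%:R) * \prod_(j < m.+1) ((nth 0 la j + (m - j))`!)%N%:R :> rat.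
  rewrite (bigD1 i) //= [in RHS](bigD1 i) //= mulrA; congr (_ * _).
    rewrite nth_incr_nth eqxx add1n addSn factS natrM; congr (_ * _).
    have im : (i <= m)%N by rewrite -ltnS.
    by rewrite /beta -natr1 natrD natrB // -[m.+1%:R]natr1; ring.
  apply: eq_bigr => j; rewrite eq_sym -val_eqE => /negPf ji.
  by rewrite nth_incr_nth ji.
rewrite /frob sumn_incr_nth factS natrM den invfM.
have nz : beta la i + m.+1%:R != 0.
  by rewrite gt_eqF // -[m.+1%:R]opprK subr_gt0 beta_gt.
set D := \prod_(j < m.+1) _; set V' := vdm _ _ in e *; set V := vdm _ _ in e *.
have Dnz : D != 0 by apply/prodf_neq0 => j _; rewrite pnatr_eq0 -lt0n fact_gt0.
set P := \prod_(k < _ | _) _ in e *; set Q := \prod_(k < _ | _) _ in e *.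
move: nz; set b := beta la i + m.+1%:R => nz.
transitivity ((sumn la).+1%:R * (sumn la)`!%:R * (V' * P) / D); first by field; rewrite Dnz nz.
by rewrite e; ring.
Qed.

Lemma big_ord_removable (la : seq nat) N (F : nat -> rat) : (size la <= N)%N ->
  \sum_(i < N | removable la i) F i = \sum_(i < size la | removable la i) F i.
Proof.
move=> sN; rewrite (big_ord_widen_cond N (removable la) F sN).
apply: eq_bigl => i; case: ltnP => [|h]; first by rewrite andbT.
by rewrite /removable [nth _ _ (val i)]nth_default // andbF ltn0.
Qed.

Lemma big_iota_ord (R : Type) (idx : R) (op : R -> R -> R) N (P : pred nat) (F : nat -> R) :
  \big[op/idx]_(i <- iota 0 N | P i) F i = \big[op/idx]_(i < N | P i) F i.
Proof. by rewrite -{1}(subn0 N) big_mkord. Qed.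

Lemma divdiff_map (F : fieldType) (x0 : F) (b : nat -> F) N g :
  (forall i j, (i < N)%N -> (j < N)%N -> b i = b j -> i = j) ->
  (forall i, (i < N)%N -> b i != x0) ->
  divdiff F (x0 :: [seq b i | i <- iota 0 N]) g
  = g x0 / \prod_(i < N) (x0 - b i)
    + \sum_(i < N) g (b i) / ((b i - x0) * \prod_(k < N | k != i) (b i - b k)).
Proof.
move=> binj bx0; rewrite /divdiff big_cons; congr (_ / _ + _).
  rewrite big_cons eqxx /= big_map big_iota_ord.
  by apply: eq_bigl => i; rewrite bx0.
rewrite big_map big_iota_ord; apply: eq_bigr => i _; congr (_ / _).
rewrite big_cons eq_sym bx0 //= big_map big_iota_ord; congr (_ * _).
apply: eq_bigl => k; rewrite -val_eqE; congr (~~ _).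
by apply/eqP/eqP => [|-> //]; apply: binj.
Qed.

Lemma uniq_divdiff_map (F : fieldType) (x0 : F) (b : nat -> F) N :
  (forall i j, (i < N)%N -> (j < N)%N -> b i = b j -> i = j) ->
  (forall i, (i < N)%N -> b i != x0) ->
  uniq (x0 :: [seq b i | i <- iota 0 N]).
Proof.
move=> binj bx0 /=; apply/andP; split.
  apply/mapP => -[i]; rewrite mem_iota add0n => /andP[_ /bx0 h] e.
  by rewrite e eqxx in h.
rewrite map_inj_in_uniq ?iota_uniq // => i j; rewrite !mem_iota !add0n /=.
exact: binj.
Qed.

Definition csum (phi : rat -> rat) (la : seq nat) : rat :=
  \sum_(i < size la) \sum_(j < nth 0%N la i) phi (j%:R - i%:R).

Lemma csum_widen phi la N : (size la <= N)%N ->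
  csum phi la = \sum_(i < N) \sum_(j < nth 0%N la i) phi (j%:R - i%:R).
Proof.
move=> h; rewrite /csum.
rewrite (big_ord_widen N (fun i => \sum_(j < nth 0%N la i) phi (j%:R - i%:R)) h).
rewrite big_mkcond; apply: eq_bigr => i _; case: ltnP => // h'.
by rewrite nth_default // big_ord0.
Qed.

Lemma csum_incr phi la i : csum phi (incr_nth la i) = csum phi la + phi (beta la i).
Proof.
pose N := maxn (size la) i.+1.
rewrite (csum_widen _ _ N); last by rewrite size_incr_nth /N; case: ifP; lia.
rewrite (csum_widen _ la N) ?leq_maxl //.
have iN : (i < N)%N by rewrite leq_maxr.
rewrite (bigD1 (Ordinal iN)) //= [in RHS](bigD1 (Ordinal iN)) //= nth_incr_nth eqxx.
rewrite add1n big_ord_recr /= [RHS]addrAC; congr (_ + _).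
apply: eq_bigr => j; rewrite eq_sym -val_eqE /= => /negPf ij.
by rewrite nth_incr_nth ij.
Qed.

Lemma eq_csum phi psi la : (forall c, phi c = psi c) -> csum phi la = csum psi la.
Proof. by move=> e; apply: eq_bigr => i _; apply: eq_bigr => j _; rewrite e. Qed.

Lemma csumD phi psi la :
  csum (fun c => phi c + psi c) la = csum phi la + csum psi la.
Proof. by rewrite -big_split; apply: eq_bigr => i _; rewrite -big_split. Qed.

Lemma csumZ a phi la : csum (fun c => a * phi c) la = a * csum phi la.
Proof. by rewrite mulr_sumr; apply: eq_bigr => i _; rewrite mulr_sumr. Qed.

Lemma csum1 la : csum (fun=> 1) la = (sumn la)%:R.
Proof.
rewrite /csum; transitivity (\sum_(i < size la) (nth 0%N la i)%:R : rat).
  by apply: eq_bigr => i _; rewrite sumr_const card_ord.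
rewrite -(big_mkord xpredT (fun i => (nth 0%N la i)%:R)).
rewrite -(big_nth 0%N xpredT (fun i : nat => i%:R)).
by rewrite -natr_sum sumnE.
Qed.

Lemma sumn_beta (la : seq nat) m : (size la <= m.+1)%N ->
  \sum_(i < m.+1) beta la i = (sumn la)%:R - (m%:R * m.+1%:R) / 2.
Proof.
move=> h; rewrite -csum1 (csum_widen _ _ _ h) /beta sumrB; congr (_ - _).
  by apply: eq_bigr => i _; rewrite sumr_const card_ord.
elim: m {h} => [|m IH]; first by rewrite big_ord1 mulr0n !mul0r.
by rewrite big_ord_recr IH /= -[m.+2%:R]natr1 -[m.+1%:R]natr1; field.
Qed.

Lemma frob_nil m : frob m [::] = 1.
Proof.
have num : vdm m.+1 (beta [::])
    = \prod_(j < m.+1) ((nth 0 [::] j + (m - j))`!)%N%:R.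
  apply: eq_bigr => j _; rewrite nth_nil add0n.
  have : (j <= m)%N by rewrite -ltnS.
  move: (nat_of_ord j) => {}j; elim: m => [|m IH] jm.
    by rewrite big1 // => k; have := ltn_ord k; lia.
  rewrite big_mkcond big_ord_recr -big_mkcond /=.
  case: ltnP => jm'; last first.
    have -> : j = m.+1 by lia.
    rewrite subnn big1 ?mulr1 // => k; have := ltn_ord k; lia.
  rewrite IH // subSn // factS mulnC natrM; congr (_ * _).
  by rewrite -subSn // natrB // /beta !nth_nil; ring.
rewrite /frob num fact0 mul1r divff //.
by apply/prodf_neq0 => j _; rewrite pnatr_eq0 -lt0n fact_gt0.
Qed.

Lemma num_SYT_nil : num_SYT [::] = 1%N.
Proof.
rewrite /num_SYT (eq_card (B := predT)); last first.
  by move=> T; rewrite !inE; apply/and3P; split; apply/forallP => -[[]].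
by rewrite card_ffun card_ord card_cell.
Qed.

(** By [frob_incr], for a removable row the summand is [(sumn la)%:R] times f_(la - i) / f_la in
    Frobenius form, so this is the branching rule for [frob]. The sum is a divided difference of a
    quadratic times the product over the zeros, hence determined by the first three moments. *)
Lemma down_sum (la : seq nat) m : is_intpart la -> (size la <= m.+1)%N ->
  \sum_(i < m.+1) (beta la i + m%:R)
     * \prod_(k < m.+1 | k != i) (beta la i - 1 - beta la k)
     / \prod_(k < m.+1 | k != i) (beta la i - beta la k) = (sumn la)%:R.
Proof.
(* The extra node [x0] makes [X] one longer than [Y]; the factor z + N of [g] below cancels its
   contribution. *)
move=> pla sla; set N := m.+1; pose x0 : rat := - N%:R.
have binj i j : (i < N)%N -> (j < N)%N -> beta la i = beta la j -> i = j.
  by move=> _ _ /eqP; rewrite beta_eq // => /eqP.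
have bx0 i : (i < N)%N -> beta la i != x0.
  by move=> iN; rewrite gt_eqF // beta_gt.
pose X := x0 :: [seq beta la i | i <- iota 0 N].
pose Y := [seq beta la i + 1 | i <- iota 0 N].
have uX : uniq X by apply: uniq_divdiff_map.
have sXY : size X = (size Y).+1 by rewrite /= !size_map.
have S0 := ddmoment0 _ _ _ uX sXY.
have S1 := ddmoment_newton _ _ _ uX sXY 0.
have S2 := ddmoment_newton _ _ _ uX sXY 1.
rewrite big_ord1 /= S0 mul1r mulr1 in S1.
rewrite 2!big_ord_recr big_ord0 /= S0 add0r S1 mulr1 in S2.
have B1 : psumdiff rat X Y 1 = - (2 * N%:R).
  rewrite /psumdiff big_cons !big_map !big_iota_ord !expr1.
  rewrite -addrA -sumrB (eq_bigr (fun=> -1)); last by move=> i _; rewrite !expr1; ring.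
  by rewrite sumr_const card_ord mulNrn /x0; ring.
have B2 : psumdiff rat X Y 2 = - (2 * (sumn la)%:R) + 2 * N%:R ^+ 2 - 2 * N%:R.
  rewrite /psumdiff big_cons !big_map !big_iota_ord.
  rewrite -addrA -sumrB (eq_bigr (fun i : 'I_N => (- 2) * beta la i + -1)); last first.
    by move=> i _; ring.
  rewrite big_split /= -mulr_sumr (sumn_beta _ _ sla) sumr_const card_ord.
  by rewrite mulNrn /x0 /N -natr1; field.
pose g z : rat := z ^+ 2 * \prod_(y <- Y) (z - y)
  + ((2 * m%:R + 1) * (z ^+ 1 * \prod_(y <- Y) (z - y))
  + (m%:R * N%:R) * (z ^+ 0 * \prod_(y <- Y) (z - y))).
have gE z : g z = (z + m%:R) * (z + N%:R) * \prod_(y <- Y) (z - y).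
  by rewrite /g /N -natr1; ring.
(* The minus sign comes from the factor of index [i] in the product over [Y] at z = beta_i, which is
   -1. *)
have dd : divdiff rat X g = - (sumn la)%:R.
  have -> : divdiff rat X g = ddmoment rat X Y 2
      + ((2 * m%:R + 1) * ddmoment rat X Y 1 + (m%:R * N%:R) * ddmoment rat X Y 0).
    by rewrite /g /ddmoment 2!divdiffD 2!divdiffZ.
  rewrite S0 S1.
  have -> : ddmoment rat X Y 2 = (psumdiff rat X Y 1 ^+ 2 + psumdiff rat X Y 2) / 2.
    by rewrite expr2 -S2; field.
  by rewrite B1 B2 /N -natr1; field.
have := divdiff_map _ x0 (beta la) N g binj bx0.
rewrite -/X dd gE addNr mulr0 !mul0r add0r => /(congr1 -%R); rewrite opprK => ->.
rewrite -sumrN; apply: eq_bigr => i _.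
have E : \prod_(k < N) (beta la i - (beta la k + 1))
    = - \prod_(k < N | k != i) (beta la i - 1 - beta la k).
  rewrite (bigD1 i) //= opprD addNKr mulN1r; congr (- _).
  by apply: eq_bigr => k _; ring.
rewrite gE big_map big_iota_ord E.
have nz1 : beta la i - x0 != 0 by rewrite subr_eq0 bx0.
have nz2 : \prod_(k < N | k != i) (beta la i - beta la k) != 0.
  by apply/prodf_neq0 => k; rewrite subr_eq0 beta_eq // eq_sym.
have -> : beta la i + N%:R = beta la i - x0 by rewrite opprK.
move: nz1 nz2; set P := \prod_(k < N | _) _; set Q := \prod_(k < N | _) _.
by set b := beta la i - x0 => h1 h2; field; rewrite h1 h2.
Qed.

(** Both sides obey the same branching recursion: [num_SYT_branch] on the left, [down_sum] on the
    right. *)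
Lemma num_SYT_frob m (la : seq nat) : is_intpart la -> (size la <= m.+1)%N ->
  (num_SYT la)%:R = frob m la.
Proof.
move: {2}(sumn la) (erefl (sumn la)) => n; elim: n la => [|n IH] la sla pla szla.
  have -> : la = [::] by apply/nilP; rewrite /nilp -leqn0 -sla size_part_le.
  by rewrite num_SYT_nil frob_nil.
rewrite (num_SYT_branch _ _ pla sla) natr_sum.
rewrite (big_ord_removable la n.+1 (fun i => (num_SYT (decr_part la i))%:R)); last first.
  by rewrite -sla size_part_le.
rewrite -(big_ord_removable la m.+1 (fun i => (num_SYT (decr_part la i))%:R)) //.
pose w (i : 'I_m.+1) := (beta la i + m%:R)
     * \prod_(k < m.+1 | k != i) (beta la i - 1 - beta la k)
     / \prod_(k < m.+1 | k != i) (beta la i - beta la k).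
have nz (i : 'I_m.+1) : \prod_(k < m.+1 | k != i) (beta la i - beta la k) != 0.
  by apply/prodf_neq0 => k; rewrite subr_eq0 beta_eq // eq_sym.
rewrite (eq_bigr (fun i => frob m la / n.+1%:R * w i)); last first.
  move=> i rem; have pd := decr_part_is_part _ _ pla rem.
  have id := incr_decr_part _ _ pla rem.
  have sd : sumn (decr_part la i) = n.
    by have := congr1 sumn id; rewrite sumn_incr_nth sla => -[].
  rewrite IH ?(leq_trans (size_decr_part _ _ rem)) //.
  have := frob_incr m (decr_part la i) i; rewrite id sd.
  have bE k : beta (decr_part la i) k = beta la k - (i == k :> nat)%:R.
    by rewrite -{2}id beta_incr; ring.
  rewrite bE eqxx.
  have bEk (k : 'I_m.+1) : k != i -> beta (decr_part la i) k = beta la k.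
    by rewrite eq_sym -val_eqE bE => /negPf ->; rewrite subr0.
  rewrite (eq_bigr (fun k : 'I_m.+1 => beta la i - 1 - beta la k)); last by move=> k /bEk ->.
  rewrite [in RHS](eq_bigr (fun k : 'I_m.+1 => beta la i - beta la k)); last first.
    by move=> k /bEk ->; rewrite /=; ring.
  move: (nz i); rewrite /w; set P := \prod_(k < _ | _) _; set Q := \prod_(k < _ | _) _.
  rewrite -[m.+1%:R]natr1 => Pnz e.
  have n0 : n.+1%:R != 0 :> rat by rewrite pnatr_eq0.
  move: n0 e; move: (n.+1%:R : rat) => nn n0 e.
  have -> : beta la i + m%:R = beta la i - true%:R + (m%:R + 1) by rewrite /=; ring.
  transitivity (frob m (decr_part la i) * nn * P / (nn * P)).
    by field; rewrite Pnz.
  by rewrite -e; field; rewrite Pnz.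
rewrite -mulr_sumr big_mkcond /=.
(* Rows that are not removable have weight 0: either row [i.+1] is equally long, which kills the
   factor of index [i.+1], or [i = m] and the row is empty, so beta_m + m = 0. *)
rewrite (eq_bigr w) => [|i _]; last first.
  case: ifP => //; rewrite /removable /w => rem; symmetry.
  case: (ltnP i m) => im.
    have hi : (i.+1 < m.+1)%N by [].
    rewrite (bigD1 (Ordinal hi)) /=; last by rewrite -val_eqE /=; lia.
    have -> : beta la i - 1 - beta la i.+1 = 0; last by rewrite mul0r mulr0 mul0r.
    have /partP[/(_ i) h _] := pla.
    have -> : beta la i.+1 = beta la i - 1; last by rewrite subrr.
    rewrite /beta -natr1.
    have -> : nth 0%N la i.+1 = nth 0%N la i by lia.
    by ring.
  have iE : i = m :> nat by have := ltn_ord i; lia.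
  have -> : beta la i + m%:R = 0; last by rewrite !mul0r.
  rewrite /beta iE subrK; move: rem; rewrite iE [nth _ _ m.+1]nth_default //.
  by case: (nth _ _ _).
by rewrite (down_sum la m pla szla) sla divfK // pnatr_eq0.
Qed.

(* The a-th moment of the content of the cell added to la by the Plancherel
   growth process, as a divided difference over the interlacing sequences of la
   extended to m.+1 rows. *)
Definition growth_moment (m : nat) (la : seq nat) (a : nat) : rat :=
  ddmoment rat (- m.+1%:R :: [seq beta la i | i <- iota 0 m.+1])
    [seq beta la i - 1 | i <- iota 0 m.+1] a.

(** By [frob_incr] the residue at beta_i is the transition probability to [incr_nth la i]; the extra
    pole accounts for the factor beta_i + m + 1. *)
Lemma growth_moment_sum m (la : seq nat) a : is_intpart la -> (size la <= m)%N ->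
  \sum_(i < m.+1) frob m (incr_nth la i) * beta la i ^+ a
  = frob m la * (sumn la).+1%:R * growth_moment m la a.
Proof.
move=> pla sla; set N := m.+1; pose x0 : rat := - N%:R.
have binj i j : (i < N)%N -> (j < N)%N -> beta la i = beta la j -> i = j.
  by move=> _ _ /eqP; rewrite beta_eq // => /eqP.
have bx0 i : (i < N)%N -> beta la i != x0.
  by move=> iN; rewrite gt_eqF // beta_gt.
rewrite /growth_moment /ddmoment (divdiff_map _ x0 (beta la) N) //.
(* Row [m] is empty because [size la <= m], so beta_m - 1 = [x0] is itself a zero and the extra pole
   contributes nothing. *)
have -> : \prod_(y <- [seq beta la i - 1 | i <- iota 0 N]) (x0 - y) = 0.
  rewrite big_map big_iota_ord big_ord_recr /=.
  have -> : x0 - (beta la m - 1) = 0; last by rewrite mulr0.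
  by rewrite /beta nth_default // /x0 /N -natr1; ring.
rewrite mulr0 mul0r add0r mulr_sumr; apply: eq_bigr => i _.
have E : \prod_(k < N) (beta la i - (beta la k - 1))
    = \prod_(k < N | k != i) (beta la i + 1 - beta la k).
  rewrite (bigD1 i) //= opprB addrC subrK mul1r.
  by apply: eq_bigr => k _; ring.
rewrite big_map big_iota_ord E.
have nz1 : beta la i - x0 != 0 by rewrite subr_eq0 bx0.
have nz2 : \prod_(k < N | k != i) (beta la i - beta la k) != 0.
  by apply/prodf_neq0 => k; rewrite subr_eq0 beta_eq // eq_sym.
have := frob_incr m la i.
have -> : beta la i + m.+1%:R = beta la i - x0 by rewrite opprK.
move: nz1 nz2; set b := beta la i - x0.
set P := \prod_(k < N | _) _; set Q := \prod_(k < _ | _) _ => h1 h2 e.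
transitivity (frob m (incr_nth la i) * b * P * beta la i ^+ a / (b * P)).
  by field; rewrite h1 h2.
by rewrite e; field; rewrite h1 h2.
Qed.

Lemma growth_moment_uniq m la : is_intpart la ->
  uniq (- m.+1%:R :: [seq beta la i | i <- iota 0 m.+1]).
Proof.
move=> pla; apply: uniq_divdiff_map => [i j _ _ /eqP | i im].
  by rewrite beta_eq // => /eqP.
by rewrite gt_eqF // beta_gt.
Qed.

Lemma growth_moment0 m la : is_intpart la -> growth_moment m la 0 = 1.
Proof.
by move=> pla; apply: ddmoment0; rewrite ?growth_moment_uniq //= !size_map.
Qed.

Definition diff2 (g : rat -> rat) (c : rat) : rat := g (c + 1) + g (c - 1) - 2 * g c.

(** Along a row the second differences telescope to the contribution of one pole and one zero; the
    boundary terms at the row starts telescope over the rows and match the pole -(m + 1). The Newton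
    coefficients thus lose their dependence on [m]. *)
Lemma growth_moment_newton m (la : seq nat) a : is_intpart la -> (size la <= m)%N ->
  a.+1%:R * growth_moment m la a.+1
  = \sum_(k < a.+1) csum (diff2 (fun c => c ^+ k.+1)) la * growth_moment m la (a - k).
Proof.
move=> pla sla; rewrite /growth_moment ddmoment_newton; first last.
- by rewrite /= !size_map.
- exact: growth_moment_uniq.
apply: eq_bigr => k _; congr (_ * _).
rewrite /psumdiff big_cons !big_map !big_iota_ord (csum_widen _ _ m.+1) ?leqW //.
rewrite -addrA -sumrB addrC.
have base : \sum_(i < m.+1) ((- i%:R) ^+ k.+1 - (- i%:R - 1) ^+ k.+1)
    = - (- m.+1%:R) ^+ k.+1 :> rat.
  elim: m.+1 => [|N IH]; first by rewrite big_ord0 oppr0 expr0n oppr0.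
  rewrite big_ord_recr /= IH -[N.+1%:R]natr1 opprD; ring.
rewrite -[X in _ + X]opprK -base -sumrB; apply: eq_bigr => i _.
rewrite /beta; elim: (nth 0%N la i) => [|p IH].
  by rewrite big_ord0 sub0r; ring.
rewrite big_ord_recr /= -IH /diff2 -natr1.
have -> : p%:R + 1 - i%:R = p%:R - i%:R + 1 :> rat by ring.
have -> : p%:R - i%:R + 1 - 1 = p%:R - i%:R :> rat by ring.
ring.
Qed.

(** * Plancherel averages of polynomials in contents *)

(* Polynomials in the content power sums, filtered by giving the a-th power sum
   weight a + 2; Plancherel averages will have degree at most half the weight. *)
Inductive wt : nat -> (seq nat -> rat) -> Prop :=
| wt_const a : wt 0 (fun=> a)
| wt_power a : wt a.+2 (csum (fun c => c ^+ a))
| wtD d F G : wt d F -> wt d G -> wt d (fun la => F la + G la)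
| wtM d e F G : wt d F -> wt e G -> wt (d + e) (fun la => F la * G la)
| wtW d e F : (d <= e)%N -> wt d F -> wt e F
| wt_ext d F G : (forall la, F la = G la) -> wt d F -> wt d G.

Lemma wtZ d a F : wt d F -> wt d (fun la => a * F la).
Proof. by rewrite -[d]add0n; apply: wtM; apply: wt_const. Qed.

Lemma wt_sum d N (F : nat -> seq nat -> rat) :
  (forall i, (i < N)%N -> wt d (F i)) -> wt d (fun la => \sum_(i < N) F i la).
Proof.
elim: N => [|N IH] h.
  apply: (wt_ext _ (fun=> 0)) => [la|]; first by rewrite big_ord0.
  exact: wtW (leq0n _) (wt_const 0).
apply: (wt_ext _ (fun la => \sum_(i < N) F i la + F N la)) => [la|].
  by rewrite big_ord_recr.
by apply: wtD; [apply: IH => i iN; apply: h; apply: ltnW | apply: h].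
Qed.

Lemma csum_sum N (phi : nat -> rat -> rat) la :
  csum (fun c => \sum_(k < N) phi k c) la = \sum_(k < N) csum (phi k) la.
Proof.
elim: N => [|N IH].
  by rewrite big_ord0 /csum big1 // => i _; rewrite big1 // => j _; rewrite big_ord0.
rewrite big_ord_recr /= -IH -csumD; apply: eq_csum => c.
by rewrite big_ord_recr.
Qed.

Lemma wt_csum d phi (a : nat -> rat) : (forall c, phi c = \sum_(k < d) a k * c ^+ k) ->
  wt d.+1 (csum phi).
Proof.
move=> e; apply: (wt_ext _ (fun la => \sum_(k < d) a k * csum (fun c => c ^+ k) la)).
  move=> la; rewrite (eq_csum _ _ _ e) (csum_sum d (fun k c => a k * c ^+ k)).
  by apply: eq_bigr => k _; rewrite csumZ.
apply: (wt_sum d.+1 d (fun k la => a k * csum (fun c => c ^+ k) la)) => k kd.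
by apply: wtZ; apply: wtW (wt_power k).
Qed.

(* The terms of degrees k and k - 1 cancel. *)
Lemma diff2_power k c :
  diff2 (fun c => c ^+ k) c
  = \sum_(j < k.-1) ((1 + (-1) ^+ (k - j)) * 'C(k, j)%:R) * c ^+ j.
Proof.
rewrite /diff2 [c + 1]addrC [c - 1]addrC !exprDn -big_split /=.
case: k => [|[|k]] /=.
- by rewrite big_ord_recr !big_ord0 /= bin0; ring.
- by rewrite !big_ord_recr !big_ord0 /= bin0 bin1 subnn subn0; ring.
rewrite 2!big_ord_recr /= subnn binn subSnn.
rewrite (eq_bigr (fun j : 'I_k.+1 => (1 + (-1) ^+ (k.+2 - j)) * 'C(k.+2, j)%:R * c ^+ j)).
  rewrite expr1n expr1 mul1r mulN1r mulNrn subrr addr0 !expr0; ring.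
by move=> j _; rewrite expr1n; ring.
Qed.

(** The two degrees lost by the second difference offset the 2 in the weight of a content power
    sum. *)
Lemma wt_diff2_power k : wt k.+1 (csum (diff2 (fun c => c ^+ k.+1))).
Proof.
exact: (wt_csum k _ (fun j => (1 + (-1) ^+ (k.+1 - j)) * 'C(k.+1, j)%:R)
  (diff2_power k.+1)).
Qed.

(** Newton's identity is solved for the highest moment; its terms have weight (k + 1) + (a - k). The
    same [G] serves every [m]. *)
Lemma wt_growth_moment a : exists2 G, wt a G &
  forall m la, is_intpart la -> (size la <= m)%N -> growth_moment m la a = G la.
Proof.
elim/ltn_ind: a => -[|a] IH.
  by exists (fun=> 1); [apply: wt_const | move=> m la pla _; rewrite growth_moment0].
have [G hG] : exists G : nat -> seq nat -> rat, forall k, (k < a.+1)%N ->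
    wt k (G k) /\ forall m la, is_intpart la -> (size la <= m)%N ->
      growth_moment m la k = G k la.
  (* The lower moments are gathered into one function by induction on their number. *)
  have {}IH : forall b, (b <= a.+1)%N -> exists G : nat -> seq nat -> rat,
      forall k, (k < b)%N -> wt k (G k) /\ forall m la, is_intpart la ->
      (size la <= m)%N -> growth_moment m la k = G k la.
    elim=> [|b IHb] hb; first by exists (fun _ _ => 0).
    have [G hG] := IHb (ltnW hb); have [G' w' e'] := IH b hb.
    exists (fun k => if k == b then G' else G k) => k; rewrite ltnS leq_eqVlt.
    by case: eqP => [-> _ //|_ /= /hG].
  exact: IH a.+1 (leqnn _).
exists (fun la => a.+1%:R^-1 * \sum_(k < a.+1)
    csum (diff2 (fun c => c ^+ k.+1)) la * G (a - k)%N la).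
  apply: wtZ; apply: (wt_sum a.+1 a.+1
    (fun k la => csum (diff2 (fun c => c ^+ k.+1)) la * G (a - k)%N la)) => k ka.
  have -> : a.+1 = (k.+1 + (a - k))%N by lia.
  by apply: wtM; [apply: wt_diff2_power | apply: (hG _ _).1; lia].
move=> m la pla sla; have n0 : a.+1%:R != 0 :> rat by rewrite pnatr_eq0.
apply: (mulfI n0); rewrite mulVKf // growth_moment_newton //.
by apply: eq_bigr => k _; rewrite (hG _ _).2 //; lia.
Qed.

(* Functions of a partition and of the content c of an added cell, of weight
   at most d - 2, where c has weight 1. *)
Inductive wtc (d : nat) : (seq nat -> rat -> rat) -> Prop :=
| wtc0 : wtc d (fun _ _ => 0)
| wtc_mon k e G : wt e G -> (k + e + 2 <= d)%N -> wtc d (fun la c => c ^+ k * G la)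
| wtcD H K : wtc d H -> wtc d K -> wtc d (fun la c => H la c + K la c)
| wtc_ext H K : (forall la c, H la c = K la c) -> wtc d H -> wtc d K.

Lemma wtcW d e H : (d <= e)%N -> wtc d H -> wtc e H.
Proof.
move=> de; elim=> [|k f G wG h|H' K _ h1 _ h2|H' K E _ h]; first exact: wtc0.
- by apply: wtc_mon wG _; apply: leq_trans h de.
- exact: wtcD.
- exact: wtc_ext E h.
Qed.

Lemma wtcMl d e F H : wt e F -> wtc d H -> wtc (e + d) (fun la c => F la * H la c).
Proof.
move=> wF; elim=> [|k f G wG h|H' K _ h1 _ h2|H' K E _ h].
- by apply: wtc_ext (wtc0 _) => la c; rewrite mulr0.
- apply: (wtc_ext _ (fun la c => c ^+ k * (F la * G la))) => [la c|]; first by ring.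
  by apply: wtc_mon (wtM _ _ _ _ wF wG) _; lia.
- by apply: wtc_ext (wtcD _ _ _ h1 h2) => la c; rewrite mulrDr.
- by apply: wtc_ext h => la c; rewrite E.
Qed.

Lemma wtcM d e H K : wtc d H -> wtc e K -> wtc (d + e) (fun la c => H la c * K la c).
Proof.
move=> wH wK; elim: wH => [|k f G wG h|H' K' _ h1 _ h2|H' K' E _ h].
- by apply: wtc_ext (wtc0 _) => la c; rewrite mul0r.
- elim: wK => [|k' f' G' wG' h'|H' K' _ h1 _ h2|H' K' E _ h1].
  + by apply: wtc_ext (wtc0 _) => la c; rewrite mulr0.
  + apply: (wtc_ext _ (fun la c => c ^+ (k + k') * (G la * G' la))) => [la c|].
      by rewrite exprD; ring.
    by apply: wtc_mon (wtM _ _ _ _ wG wG') _; lia.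
  + by apply: wtc_ext (wtcD _ _ _ h1 h2) => la c; rewrite mulrDr.
  + by apply: wtc_ext h1 => la c; rewrite E.
- by apply: wtc_ext (wtcD _ _ _ h1 h2) => la c; rewrite mulrDl.
- by apply: wtc_ext h => la c; rewrite E.
Qed.

(** The bound [k + e + 2 <= d] leaves no monomial. This case is kept apart because [d - 2] truncates
    at 0. *)
Lemma wtc_low d H : (d < 2)%N -> wtc d H -> forall la c, H la c = 0.
Proof.
move=> d2; elim=> [//|k f G wG h|H' K _ h1 _ h2 la c|H' K E _ h la c].
- by exfalso; lia.
- by rewrite h1 h2 addr0.
- by rewrite -E h.
Qed.

(** Products use the discrete Leibniz rule, including the product of the two increments. *)
Lemma wt_incr d F : wt d F -> exists2 H, wtc d H &
  forall la i, F (incr_nth la i) = F la + H la (beta la i).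
Proof.
elim=> {d F} [a|a|d F G wF [H wH hF] wG [K wK hG]|d e F G wF [H wH hF] wG [K wK hG]
  |d e F de wF [H wH hF]|d F G E wF [H wH hF]].
- by exists (fun _ _ => 0); [apply: wtc0 | move=> la i; rewrite addr0].
- exists (fun la c => c ^+ a * 1); last by move=> la i; rewrite csum_incr mulr1.
  by apply: wtc_mon (wt_const 1) _; lia.
- exists (fun la c => H la c + K la c); first exact: wtcD.
  by move=> la i; rewrite hF hG; ring.
- exists (fun la c => F la * K la c + (G la * H la c + H la c * K la c)).
    apply: wtcD; first exact: wtcMl.
    by apply: wtcD; [rewrite addnC; apply: wtcMl | apply: wtcM].
  by move=> la i; rewrite hF hG; ring.
- by exists H => //; apply: wtcW de wH.
- by exists H => // la i; rewrite -!E.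
Qed.

Lemma wtc_mean d H : wtc d H -> exists2 G, wt (d - 2) G &
  forall la m, is_intpart la -> (size la <= m)%N ->
    \sum_(i < m.+1) frob m (incr_nth la i) * H la (beta la i)
    = frob m la * (sumn la).+1%:R * G la.
Proof.
elim=> [|k e G wG h|H' K _ [G1 w1 h1] _ [G2 w2 h2]|H' K E _ [G w h]].
- exists (fun=> 0); first exact: wtW (leq0n _) (wt_const 0).
  by move=> la m _ _; rewrite mulr0 big1 // => i _; rewrite mulr0.
- have [M wM hM] := wt_growth_moment k; exists (fun la => M la * G la).
    by apply: wtW (wtM _ _ _ _ wM wG); lia.
  move=> la m pla sla; rewrite -(hM m) // mulrA -growth_moment_sum // mulr_suml.
  by apply: eq_bigr => i _; rewrite mulrA.
- exists (fun la => G1 la + G2 la); first exact: wtD.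
  move=> la m pla sla; rewrite mulrDr -h1 // -h2 // -big_split /=.
  by apply: eq_bigr => i _; rewrite mulrDr.
- exists G => // la m pla sla; rewrite -h //.
  by apply: eq_bigr => i _; rewrite E.
Qed.

Definition plancherel (n : nat) (F : seq nat -> rat) : rat :=
  (n`!)%:R^-1 * \sum_(la : intpart n) (num_SYT la)%:R ^+ 2 * F la.

Lemma sum_intpart1 n (s : seq nat) (F : seq nat -> rat) :
  \sum_(la : intpart n | val la == s) F la
  = if is_intpart s && (sumn s == n) then F s else 0.
Proof.
case: ifP => h.
  by rewrite (big_pred1 (IntPart h)) // => la; rewrite -val_eqE.
rewrite big1 // => la /eqP e; have := valP la; rewrite e /= h //.
Qed.

(** The shape breaks only if rows [i.-1] and [i] are equally long; then beta_(i-1) = beta_i + 1, and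
    the right side of [frob_incr] is 0 while the other factors on the left are not. *)
Lemma frob_incr_eq0 m (la : seq nat) (i : 'I_m.+1) :
  is_intpart la -> ~~ is_intpart (incr_nth la i) -> frob m (incr_nth la i) = 0.
Proof.
move=> pla npart.
have [i0 hi] : (0 < i)%N /\ nth 0%N la i.-1 = nth 0%N la i.
  case: (boolP ((i == 0 :> nat) || (nth 0 la i < nth 0 la i.-1)%N)) => h; last first.
    move: h; rewrite negb_or -lt0n -leqNgt => /andP[i0 h]; split=> //.
    by apply/eqP; rewrite eqn_leq h /= part_le // leq_pred.
  exfalso; move/negP: npart; apply; have /partP[dec pos] := pla.
  have isz : (i <= size la)%N.
    rewrite leqNgt; apply/negP => hs; move/orP: h => [/eqP|]; first lia.
    by rewrite [X in (_ < X)%N]nth_default //; lia.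
  apply/partP; split=> j; rewrite ?size_incr_nth !nth_incr_nth.
    have dj := dec j; case: (nat_of_ord i =P j.+1) => [ij|_]; last by case: eqP; lia.
    by move: h; rewrite ij /=; case: eqP; lia.
  case: ifP => hsz hj; first by have := pos j hj; lia.
  case: eqP => // ij; rewrite add0n; apply: pos; lia.
have := frob_incr m la i.
have im : (i.-1 < m.+1)%N by have := ltn_ord i; lia.
rewrite [X in _ = _ * X](bigD1 (Ordinal im)) /=; last by rewrite -val_eqE /=; lia.
have -> : beta la i + 1 - beta la i.-1 = 0.
  rewrite /beta hi; have -> : (i%:R : rat) = (i.-1)%:R + 1 by rewrite natr1 prednK.
  by ring.
rewrite mul0r mulr0 => /eqP; rewrite mulf_eq0 mulf_eq0 -orbA => /or3P[/eqP //| |].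
- by rewrite gt_eqF // -[m.+1%:R]opprK subr_gt0 beta_gt.
- suff /negPf -> : \prod_(k < m.+1 | k != i) (beta la i - beta la k) != 0 by [].
  by apply/prodf_neq0 => k; rewrite subr_eq0 beta_eq // eq_sym.
Qed.

(** One of the two factors [num_SYT La] is expanded by branching, and the pairs (la, La) are then
    summed over [la] first. The other factor becomes [frob], so the inner sum may include the rows
    that cannot be extended. *)
Lemma plancherel_growth n (F : seq nat -> rat) :
  \sum_(La : intpart n.+1) (num_SYT La)%:R ^+ 2 * F La
  = \sum_(la : intpart n) (num_SYT la)%:R
      * \sum_(i < n.+1) frob n (incr_nth la i) * F (incr_nth la i).
Proof.
have partn k (la : intpart k) : is_intpart la by have /andP[] := valP la.
have sumk k (la : intpart k) : sumn la = k by have /andP[_ /eqP] := valP la.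
transitivity (\sum_(La : intpart n.+1) \sum_(i < n.+1) \sum_(la : intpart n | incr_nth la i == La)
   (num_SYT la)%:R * ((num_SYT La)%:R * F La)).
  apply: eq_bigr => La _.
  rewrite expr2 {1}(num_SYT_branch _ n) // natr_sum -mulrA mulr_suml big_mkcond /=.
  apply: eq_bigr => i _; rewrite -mulr_suml; case: ifP => rem.
    rewrite (eq_bigl (fun la : intpart n => val la == decr_part La i)).
      rewrite (sum_intpart1 _ _ (fun la => (num_SYT la)%:R)) decr_part_is_part //=.
      have -> // : sumn (decr_part La i) == n.
      have := congr1 sumn (incr_decr_part _ _ (partn _ La) rem).
      by rewrite sumn_incr_nth sumk => -[->].
    move=> la; apply/eqP/eqP => [e|->]; last by rewrite incr_decr_part.
    apply: (incr_part_inj i) => //; first exact: partn; first exact: decr_part_is_part.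
    by rewrite incr_decr_part.
  rewrite big1 ?mul0r // => la /eqP e.
  by move: rem; rewrite -e removable_incr.
rewrite exchange_big /= (eq_bigr (fun i : 'I_n.+1 => \sum_(la : intpart n)
  (num_SYT la)%:R * (frob n (incr_nth la i) * F (incr_nth la i)))); last first.
  move=> i _; rewrite (exchange_big_dep xpredT) //=; apply: eq_bigr => la _.
  rewrite -mulr_sumr; congr (_ * _).
  rewrite (eq_bigl (fun La : intpart n.+1 => val La == incr_nth la i)); last first.
    by move=> La; rewrite eq_sym.
  rewrite (sum_intpart1 _ _ (fun la => (num_SYT la)%:R * F la)).
  rewrite sumn_incr_nth sumk eqxx andbT; case: ifP => h.
    rewrite (num_SYT_frob n) //.
    rewrite size_incr_nth; have := size_part_le _ (partn _ la); rewrite sumk => hs.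
    by case: ifP => _; [apply: leqW | apply: ltn_ord].
  by rewrite frob_incr_eq0 ?mul0r // h.
by rewrite exchange_big /=; apply: eq_bigr => la _; rewrite mulr_sumr.
Qed.

Lemma plancherel_step d F : wt d F ->
  (if (d < 2)%N then forall n, plancherel n.+1 F = plancherel n F
   else exists2 G, wt (d - 2) G &
     forall n, plancherel n.+1 F - plancherel n F = plancherel n G).
Proof.
move=> /wt_incr[H wH hF]; have [G wG hG] := wtc_mean _ _ wH.
have step n : plancherel n.+1 F - plancherel n F = plancherel n G.
  rewrite /plancherel plancherel_growth.
  have E (la : intpart n) : \sum_(i < n.+1) frob n (incr_nth la i) * F (incr_nth la i)
     = (num_SYT la)%:R * n.+1%:R * (F la + G la).
    have /andP[pla /eqP sla] := valP la.
    have szla : (size la <= n)%N by have := size_part_le _ pla; rewrite sla.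
    have := growth_moment_sum n la 0 pla szla; rewrite growth_moment0 // mulr1 => e0.
    rewrite mulrDr (num_SYT_frob n) ?leqW //.
    have := hG la n pla szla; rewrite sla => <-; rewrite sla in e0.
    rewrite -e0 mulr_suml -big_split /=; apply: eq_bigr => i _.
    by rewrite hF expr0; ring.
  rewrite factS natrM invfM.
  have n0 : n.+1%:R != 0 :> rat by rewrite pnatr_eq0.
  have -> : \sum_(la : intpart n) (num_SYT la)%:R *
     (\sum_(i < n.+1) frob n (incr_nth la i) * F (incr_nth la i))
     = n.+1%:R * (\sum_(la : intpart n) (num_SYT la)%:R ^+ 2 * F la
                + \sum_(la : intpart n) (num_SYT la)%:R ^+ 2 * G la).
    rewrite -big_split /= mulr_sumr; apply: eq_bigr => la _; rewrite E; ring.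
  by rewrite mulrACA mulVf // mul1r mulrDr addrAC subrr add0r.
case: ifP => d2; last by exists G.
move=> n; apply/eqP; rewrite -subr_eq0 step.
(* With [H = 0] the mean formula gives [num_SYT la] times [G la] equal to 0 for each shape, so the
   increment vanishes termwise. *)
have low := wtc_low _ _ d2 wH.
rewrite /plancherel big1 ?mulr0 // => la _.
have /andP[pla /eqP sla] := valP la.
have szla : (size la <= n)%N by have := size_part_le _ pla; rewrite sla.
have := hG la n pla szla; rewrite big1 => [/esym/eqP|i _]; last by rewrite low mulr0.
rewrite -(num_SYT_frob n) ?leqW // !mulf_eq0 !pnatr_eq0 /= orbF => /orP[/eqP -> | /eqP ->].
- by rewrite expr0n mul0r.
- by rewrite mulr0.
Qed.

(** The [m]-th finite difference vanishes; equivalently, [u] is a polynomial sequence of degree less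
    than [m]. *)
Fixpoint ddeg (m : nat) (u : nat -> rat) : Prop :=
  if m is m'.+1 then ddeg m' (fun n => u n.+1 - u n) else forall n, u n = 0.

Lemma ddeg_ext m u v : (forall n, u n = v n) -> ddeg m u -> ddeg m v.
Proof.
elim: m u v => [|m IH] u v e /=; first by move=> h n; rewrite -e.
by apply: IH => n; rewrite !e.
Qed.

Lemma ddegB m u v : ddeg m u -> ddeg m v -> ddeg m (fun n => u n - v n).
Proof.
elim: m u v => [|m IH] u v /= hu hv; first by move=> n; rewrite hu hv subrr.
by apply: ddeg_ext (IH _ _ hu hv) => n; ring.
Qed.

Lemma ddegZ m a u : ddeg m u -> ddeg m (fun n => a * u n).
Proof.
elim: m u => [|m IH] u /= hu; first by move=> n; rewrite hu mulr0.
by apply: ddeg_ext (IH _ hu) => n; ring.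
Qed.

Lemma ddeg_bin k : ddeg k.+1 (fun n => 'C(n, k)%:R).
Proof.
elim: k => [|k IH]; first by move=> n; rewrite !bin0 subrr.
by apply: ddeg_ext IH => n; rewrite binS natrD addrC addKr.
Qed.

Lemma ddeg_eq0 m u : ddeg m u -> (forall n, (n < m)%N -> u n = 0) -> forall n, u n = 0.
Proof.
elim: m u => [|m IH] u //= hu h0.
have du n : u n.+1 - u n = 0.
  by apply: (IH (fun n => u n.+1 - u n)) => // k km; rewrite !h0 ?subrr //; lia.
elim=> [|n IHn]; first exact: h0.
by apply/eqP; rewrite -IHn -subr_eq0 du.
Qed.

(** Newton's forward interpolation formula, in which only the last term survives. *)
Lemma ddeg_interp m u : ddeg m.+1 u -> (forall n, (n < m)%N -> u n = 0) ->
  forall n, u n = u m * 'C(n, m)%:R.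
Proof.
move=> hu h0 n; apply/eqP; rewrite -subr_eq0; apply/eqP; move: n.
apply: (ddeg_eq0 m.+1 (fun n => u n - u m * 'C(n, m)%:R)).
  by apply: ddegB => //; apply: ddegZ; apply: ddeg_bin.
move=> n; rewrite ltnS leq_eqVlt => /orP[/eqP->|nm].
  by rewrite binn mulr1 subrr.
by rewrite h0 // bin_small // mulr0 subrr.
Qed.

Lemma plancherel_ddeg d F : wt d F -> ddeg (d./2).+1 (fun n => plancherel n F).
Proof.
elim/ltn_ind: d F => d IH F wF; have := plancherel_step _ _ wF.
case: ltnP => d2.
  move=> e; have -> : d./2 = 0%N by case: d d2 {IH wF} => [|[]].
  by move=> n; rewrite e subrr.
move=> [G wG e]; have -> : d./2 = ((d - 2)./2).+1 by lia.
have lt : (d - 2 < d)%N by lia.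
by apply: ddeg_ext (IH _ lt _ wG) => n; rewrite e.
Qed.

(** * Hook lengths and contents *)

Lemma telescope_ord (phi : nat -> rat) n :
  \sum_(j < n) (phi j.+1 - phi j) = phi n - phi 0%N.
Proof. by rewrite -(big_mkord xpredT (fun j => phi j.+1 - phi j)) telescope_sumr. Qed.

(* The hook lengths of the first row complement the differences of first-column
   hook lengths in {1, ..., m + size mu}. *)
Lemma row_hooks (g : rat -> rat) m (mu : seq nat) :
  sorted geq mu -> all (fun x => x <= m)%N mu ->
  \sum_(j < m) g (m - j + count (ltn j) mu)%N%:R
  + \sum_(k < size mu) g (m%:R - (nth 0%N mu k)%:R + k%:R + 1)
  = \sum_(t < m + size mu) g t.+1%:R.
Proof.
elim/last_ind: mu => [_ _|mu x IH].
  rewrite big_ord0 addr0 /= addn0 (reindex_inj rev_ord_inj) /=.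
  by apply: eq_bigr => j _; congr (g _%:R); have := ltn_ord j; lia.
have tr : transitive geq by move=> a b c /= h1 h2; apply: leq_trans h2 h1.
rewrite (sorted_pairwise tr) pairwise_rcons -(sorted_pairwise tr) all_rcons.
move=> /andP[amu smu] /andP[xm am].
set M := size mu; rewrite size_rcons addnS !big_ord_recr /= -IH //.
rewrite nth_rcons ltnn eqxx.
have -> : \sum_(k < M) g (m%:R - (nth 0%N (rcons mu x) k)%:R + k%:R + 1)
  = \sum_(k < M) g (m%:R - (nth 0%N mu k)%:R + k%:R + 1).
  by apply: eq_bigr => k _; rewrite nth_rcons ltn_ord.
(* Appending the smallest part [x] lengthens the legs of the first [x] columns only. There every
   part of [mu] is already counted, so the hook grows from m - j + M to m - j + M + 1 and the change
   telescopes. *)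
suff E : \sum_(j < m) g (m - j + count (ltn j) (rcons mu x))%N%:R
  - \sum_(j < m) g (m - j + count (ltn j) mu)%N%:R
  = g (m + M).+1%:R - g (m%:R - x%:R + M%:R + 1).
  by rewrite -[X in X + _ = _](subrK (\sum_(j < m) g (m - j + count (ltn j) mu)%N%:R)) E; ring.
pose phi j := g ((m + M).+1%:R - j%:R).
rewrite -sumrB (eq_bigr (fun j : 'I_m => if (j < x)%N then phi j - phi j.+1 else 0)).
  rewrite -big_mkcond /= -(big_ord_widen m (fun j => phi j - phi j.+1) xm).
  rewrite -[LHS]opprK -sumrN (eq_bigr (fun j : 'I_x => phi j.+1 - phi j)); last first.
    by move=> j _; rewrite opprB.
  rewrite telescope_ord opprB /phi subr0 -natr1 natrD; congr (_ - g _); ring.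
move=> j _; rewrite -cats1 count_cat /= addn0.
case: ifP => jx; last by rewrite addn0 subrr.
have cM : count (ltn j) mu = M.
  by apply/eqP; rewrite -all_count; apply: sub_all amu => y; apply: leq_trans.
have jm := ltn_ord j; rewrite cM /phi -!natrB; [|lia|lia].
by congr (g _%:R - g _%:R); lia.
Qed.

Lemma csum_cons phi m (mu : seq nat) :
  csum phi (m :: mu) = \sum_(j < m) phi j%:R + csum (fun c => phi (c - 1)) mu.
Proof.
rewrite /csum /= big_ord_recl /=; congr (_ + _).
  by apply: eq_bigr => j _; rewrite subr0.
apply: eq_bigr => i _; apply: eq_bigr => j _; congr phi.
by rewrite /bump /= add1n -natr1; ring.
Qed.

Definition hook_sum (g : rat -> rat) (la : seq nat) : rat :=
  \sum_(u : cell la) g (hook_length u)%:R.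

Lemma hook_sumE g la : hook_sum g la = \sum_(i < size la) \sum_(j < nth 0%N la i)
  g ((nth 0 la i - j.+1) + (conj_part la j - i.+1) + 1)%N%:R.
Proof.
exact: (sum_cells la rat (fun i j =>
  g ((nth 0 la i - j.+1) + (conj_part la j - i.+1) + 1)%N%:R)).
Qed.

Lemma hook_sum_cons g m (mu : seq nat) : all (fun x => x <= m)%N mu ->
  hook_sum g (m :: mu)
  = \sum_(j < m) g (m - j + count (ltn j) mu)%N%:R + hook_sum g mu.
Proof.
move=> am; rewrite !hook_sumE /= big_ord_recl /=; congr (_ + _).
  apply: eq_bigr => j _; congr (g _%:R); rewrite /conj_part /= ltn_ord.
  by have := ltn_ord j; lia.
apply: eq_bigr => i _; apply: eq_bigr => j _; congr (g _%:R).
rewrite /bump /= add1n /conj_part /=.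
have -> : (j < m)%N.
  have /(allP am) /= h : nth 0%N mu i \in mu by apply: mem_nth.
  exact: leq_trans (ltn_ord j) h.
by rewrite add1n subSS.
Qed.

Lemma sum_diff2 g c n :
  \sum_(j < n) diff2 g (j%:R - c) = g (n%:R - c) - g (n%:R - c - 1)
    - (g (- c) - g (- c - 1)).
Proof.
pose phi j := g (j%:R - c) - g (j%:R - c - 1).
transitivity (\sum_(j < n) (phi j.+1 - phi j)); last first.
  by rewrite telescope_ord /phi mulr0n sub0r.
apply: eq_bigr => j _; rewrite /phi /diff2 -[j.+1%:R]natr1.
have -> : j%:R + 1 - c = j%:R - c + 1 by ring.
by rewrite addrK; ring.
Qed.

(** Turns the correction term of [row_hooks], which involves row lengths, into a sum over the cells
    of [mu] by telescoping along its rows. *)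
Lemma csum_telescope g m (mu : seq nat) :
  csum (fun c => g (m%:R - c + 1) - g (m%:R - c)) mu
  = \sum_(k < size mu) g (m + k).+1%:R
    - \sum_(k < size mu) g (m%:R - (nth 0%N mu k)%:R + k%:R + 1).
Proof.
rewrite /csum -sumrB; apply: eq_bigr => k _.
pose phi j := - g (m%:R - (j%:R - k%:R) + 1).
transitivity (\sum_(j < nth 0%N mu k) (phi j.+1 - phi j)).
  apply: eq_bigr => j _; rewrite /phi -natr1 opprK addrC; congr (- g _ + _); ring.
rewrite telescope_ord /phi opprK addrC mulr0n -natr1 natrD.
by congr (g _ - g _); ring.
Qed.

(** Removing the first row keeps the other hooks and shifts the remaining contents by 1, which
    content differences do not see. [row_hooks] handles the removed hooks; evenness makes the two
    cross terms between that row and the rest equal. *)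
Lemma hook_sum_content g (la : seq nat) : (forall x, g (- x) = g x) -> is_intpart la ->
  2 * hook_sum g la
  = 2 * csum g la + csum (fun x => csum (fun y => diff2 g (x - y)) la) la.
Proof.
move=> even /andP[srt _]; elim: la srt => [|m mu IH] srt.
  by rewrite hook_sumE /csum !big_ord0 !mulr0 addr0.
have tr : transitive geq by move=> a b c /= h1 h2; apply: leq_trans h2 h1.
have am : all (fun x => x <= m)%N mu by apply: order_path_min srt.
have smu := path_sorted srt.
have ediff x : diff2 g (- x) = diff2 g x.
  rewrite /diff2 even; have -> : - x + 1 = - (x - 1) by ring.
  have -> : - x - 1 = - (x + 1) by ring.
  by rewrite !even; ring.
rewrite hook_sum_cons // mulrDr IH //.
have := row_hooks g m mu smu am; set S := \sum_(j < m) g _ => hS.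
have {hS} -> : S = \sum_(t < m + size mu) g t.+1%:R
   - \sum_(k < size mu) g (m%:R - (nth 0%N mu k)%:R + k%:R + 1) by rewrite -hS addrK.
rewrite big_split_ord /=.
have := csum_telescope g m mu; set T := \sum_(k < size mu) g _ => hT.
have {hT} -> : \sum_(t < m) g t.+1%:R + T
   - \sum_(k < size mu) g (m%:R - (nth 0%N mu k)%:R + k%:R + 1)
   = \sum_(t < m) g t.+1%:R + csum (fun c => g (m%:R - c + 1) - g (m%:R - c)) mu.
  by rewrite hT; ring.
rewrite !csum_cons.
(* Pairs inside the first row collapse to 2 (g(m) - g(0)); what remains is the cross term, which
   [E2] meets again and [E3] evaluates. *)
have E1 : \sum_(j < m) csum (fun y => diff2 g (j%:R - y)) (m :: mu)
  = 2 * (g m%:R - g 0) + csum (fun c => \sum_(j < m) diff2 g (j%:R - (c - 1))) mu.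
  rewrite (csum_sum m (fun j c => diff2 g (j%:R - (c - 1)))).
  rewrite (eq_bigr (fun j : 'I_m => \sum_(i < m) diff2 g (j%:R - i%:R)
     + csum (fun y => diff2 g (j%:R - (y - 1))) mu)); last by move=> j _; rewrite csum_cons.
  rewrite big_split /=; congr (_ + _).
  rewrite exchange_big /= (eq_bigr (fun i : 'I_m =>
     (g i.+1%:R - g i%:R) - (g (m%:R - i.+1%:R) - g (m%:R - i%:R)))); last first.
    move=> i _; rewrite sum_diff2.
    have -> : - i%:R - 1 = - (i.+1%:R) :> rat by rewrite -natr1; ring.
    have -> : m%:R - i%:R - 1 = m%:R - i.+1%:R :> rat by rewrite -natr1; ring.
    by rewrite !even; ring.
  rewrite sumrB (telescope_ord (fun i => g i%:R)) (telescope_ord (fun i => g (m%:R - i%:R))).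
  by rewrite subrr subr0 mulr0n; ring.
rewrite E1.
have E2 : csum (fun c => csum (fun y => diff2 g (c - 1 - y)) (m :: mu)) mu
  = csum (fun c => \sum_(j < m) diff2 g (j%:R - (c - 1))) mu
    + csum (fun x => csum (fun y => diff2 g (x - y)) mu) mu.
  rewrite -csumD; apply: eq_csum => c; rewrite csum_cons; congr (_ + _).
    by apply: eq_bigr => j _; rewrite -ediff opprB.
  by apply: eq_csum => y; congr diff2; ring.
rewrite E2.
have E3 : csum (fun c => \sum_(j < m) diff2 g (j%:R - (c - 1))) mu
  = csum (fun c => g (m%:R - c + 1) - g (m%:R - c)) mu
    - csum (fun c => g (c - 1)) mu + csum g mu.
  rewrite -addrA -[- csum _ mu]mulN1r -csumZ -!csumD; apply: eq_csum => c; rewrite sum_diff2.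
  have -> : m%:R - (c - 1) - 1 = m%:R - c by ring.
  have -> : m%:R - (c - 1) = m%:R - c + 1 by ring.
  have -> : - (c - 1) - 1 = - c by ring.
  by rewrite !even; ring.
rewrite E3.
have E4 : \sum_(t < m) g t.+1%:R = \sum_(t < m) g t%:R + (g m%:R - g 0).
  by rewrite -[g 0]/(g 0%:R) -(telescope_ord (fun t => g t%:R)) sumrB; ring.
rewrite E4; ring.
Qed.

Definition csum2 (phi : rat -> rat) (la : seq nat) : rat :=
  csum (fun x => csum (fun y => phi (x - y)) la) la.

Lemma eq_csum2 phi psi la : (forall c, phi c = psi c) -> csum2 phi la = csum2 psi la.
Proof. by move=> e; apply: eq_csum => x; apply: eq_csum => y. Qed.

Lemma csum2_sum N (a : nat -> rat) (phi : nat -> rat -> rat) la :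
  csum2 (fun c => \sum_(k < N) a k * phi k c) la = \sum_(k < N) a k * csum2 (phi k) la.
Proof.
rewrite /csum2 (eq_csum _ (fun x => \sum_(k < N) a k * csum (fun y => phi k (x - y)) la)).
  rewrite (csum_sum N (fun k x => a k * csum (fun y => phi k (x - y)) la)).
  by apply: eq_bigr => k _; rewrite csumZ.
move=> x; rewrite (csum_sum N (fun k y => a k * phi k (x - y))).
by apply: eq_bigr => k _; rewrite csumZ.
Qed.

Lemma wt_csum2_power j : wt j.+4 (csum2 (fun c => c ^+ j)).
Proof.
apply: (wt_ext _ (fun la => \sum_(i < j.+1) ((-1) ^+ i * 'C(j, i)%:R) *
   (csum (fun c => c ^+ (j - i)) la * csum (fun c => c ^+ i) la))) => [la|].
  rewrite /csum2 (eq_csum _ (fun x => \sum_(i < j.+1) ((-1) ^+ i * 'C(j, i)%:R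
    * csum (fun c => c ^+ i) la) * x ^+ (j - i))).
    rewrite (csum_sum _ (fun i x => ((-1) ^+ i * 'C(j, i)%:R
      * csum (fun c => c ^+ i) la) * x ^+ (j - i))).
    by apply: eq_bigr => i _; rewrite csumZ; ring.
  move=> x; rewrite (eq_csum _ (fun y => \sum_(i < j.+1)
     ((-1) ^+ i * 'C(j, i)%:R * x ^+ (j - i)) * y ^+ i)).
    rewrite (csum_sum _ (fun i y => ((-1) ^+ i * 'C(j, i)%:R * x ^+ (j - i)) * y ^+ i)).
    by apply: eq_bigr => i _; rewrite csumZ; ring.
  by move=> y; rewrite exprBn; apply: eq_bigr => i _; rewrite -mulr_natr; ring.
apply: (wt_sum _ _ (fun i la => ((-1) ^+ i * 'C(j, i)%:R) *
   (csum (fun c => c ^+ (j - i)) la * csum (fun c => c ^+ i) la))) => i ij.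
apply: wtZ; have -> : j.+4 = ((j - i).+2 + i.+2)%N by lia.
by apply: wtM; apply: wt_power.
Qed.

(** A double sum of c^j has weight j + 4, but the second difference only leaves j <= k - 2. The
    quadratic part thus has weight k + 2, like the linear part. *)
Lemma wt_csum2_diff2_power e k : (k.+2 <= e)%N ->
  wt e (csum2 (diff2 (fun c => c ^+ k))).
Proof.
move=> ke; pose a j : rat := (1 + (-1) ^+ (k - j)) * 'C(k, j)%:R.
apply: (wt_ext _ (fun la => \sum_(j < k.-1) a j * csum2 (fun c => c ^+ j) la)) => [la|].
  by rewrite (eq_csum2 _ _ la (diff2_power k)) (csum2_sum _ a (fun j c => c ^+ j)).
apply: (wt_sum _ _ (fun j la => a j * csum2 (fun c => c ^+ j) la)) => j jk.
by apply: wtZ; apply: wtW (wt_csum2_power j); lia.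
Qed.

Lemma wt_hook_sum (p : {poly rat}) : (forall x, p.[- x] = p.[x]) ->
  exists2 F, wt (size p).+1 F &
    forall la, is_intpart la -> hook_sum (horner p) la = F la.
Proof.
move=> even; exists (fun la => csum (horner p) la + 2^-1 * csum2 (diff2 (horner p)) la).
  apply: wtD; first exact: (wt_csum _ _ (fun i => p`_i) (horner_coef p)).
  apply: wtZ; apply: (wt_ext _ (fun la => \sum_(k < size p)
     p`_k * csum2 (diff2 (fun c => c ^+ k)) la)) => [la|].
    rewrite -(csum2_sum _ (fun k => p`_k) (fun k => diff2 (fun c => c ^+ k))).
    apply: eq_csum2 => c; rewrite /diff2 !horner_coef mulr_sumr -big_split -sumrB /=.
    by apply: eq_bigr => k _; ring.
  apply: (wt_sum _ _ (fun k la => p`_k * csum2 (diff2 (fun c => c ^+ k)) la)) => k kp.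
  by apply: wtZ; apply: wt_csum2_diff2_power.
move=> la pla; have two : 2 != 0 :> rat by [].
by apply: (mulfI two); rewrite mulrDr mulVKf // hook_sum_content.
Qed.

(** * The value at n = r + 1 *)

Definition hook_poly (r : nat) : {poly rat} :=
  \prod_(1 <= i < r.+1) ('X^2 - (i%:R ^+ 2)%:P).

Lemma hook_polyE r x : (hook_poly r).[x] = \prod_(1 <= i < r.+1) (x ^+ 2 - i%:R ^+ 2).
Proof. by rewrite horner_prod; apply: eq_bigr => i _; rewrite !hornerE. Qed.

Lemma size_hook_poly r : (size (hook_poly r) <= r.*2.+1)%N.
Proof.
elim: r => [|r IH]; first by rewrite /hook_poly big_geq // size_poly1.
rewrite /hook_poly big_nat_recr //=; apply: leq_trans (size_polyMleq _ _) _.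
have : (size ('X^2 - (r.+1%:R ^+ 2)%:P : {poly rat})%R <= 3)%N.
  apply: leq_trans (size_polyD _ _) _; rewrite size_polyXn size_polyN geq_max /=.
  exact: leq_trans (size_polyC_leq1 _) _.
rewrite -/(hook_poly r) => h3; have := leq_add IH h3.
by rewrite doubleS; case: (_ + _)%N => //= n; rewrite addnS ltnS addnC.
Qed.

Lemma plancherel_ext n F G : (forall la, is_intpart la -> F la = G la) ->
  plancherel n F = plancherel n G.
Proof.
move=> e; congr (_ * _); apply: eq_bigr => la _; rewrite e //.
by have /andP[] := valP la.
Qed.

Lemma hook_avg_ddeg r :
  ddeg r.+2 (fun n => plancherel n (hook_sum (horner (hook_poly r)))).
Proof.
have [x|F wF hF] := wt_hook_sum (hook_poly r).
  by rewrite !hook_polyE; apply: eq_bigr => i _; rewrite sqrrN.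
apply: (ddeg_ext _ (fun n => plancherel n F)) => [n|].
  by apply: plancherel_ext => la /hF.
have le : ((size (hook_poly r)).+1 <= r.*2.+2)%N by rewrite ltnS size_hook_poly.
by have := plancherel_ddeg _ _ (wtW _ _ _ le wF); rewrite /= doubleK.
Qed.

Lemma nth_size_sumn (s : seq nat) i : 0%N \notin s -> (i < size s)%N ->
  (nth 0 s i + size s <= (sumn s).+1)%N.
Proof.
elim: s i => // p s IH [|i] /=; rewrite inE negb_or eq_sym -lt0n => /andP[p0 s0] hi.
  by have := size_le_sumn _ s0; lia.
by have := IH i s0 hi; lia.
Qed.

(** Row [crow u] and the first column together have at most [sumn la] cells. The slack
    [crow u + ccol u] later shows that only the corner can have a hook containing all cells. *)
Lemma hook_length_le (la : seq nat) (u : cell la) : is_intpart la ->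
  (hook_length u + crow u + ccol u <= sumn la)%N.
Proof.
move=> /andP[_ n0]; have := nth_size_sumn _ _ n0 (crow_lt _ u).
have := ccol_lt _ u; have := crow_lt _ u; have := count_size (ltn (ccol u)) la.
by rewrite /hook_length /conj_part; lia.
Qed.

Lemma hook_poly_root r h : (0 < h <= r)%N -> (hook_poly r).[h%:R] = 0.
Proof.
move=> hr; rewrite hook_polyE (bigD1_seq h) ?iota_uniq //=; last by rewrite mem_index_iota.
by rewrite subrr mul0r.
Qed.

Lemma hook_length_gt0 (la : seq nat) (u : cell la) : (0 < hook_length u)%N.
Proof. by rewrite /hook_length addn1. Qed.

Lemma hook_avg_small r n : (n <= r)%N ->
  plancherel n (hook_sum (horner (hook_poly r))) = 0.
Proof.
move=> nr; rewrite /plancherel big1 ?mulr0 // => la _.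
have /andP[pla /eqP sla] := valP la.
rewrite /hook_sum big1 ?mulr0 // => u _; apply: hook_poly_root.
by rewrite hook_length_gt0; have := hook_length_le _ u pla; rewrite sla; lia.
Qed.

Definition hook_shape (a b : nat) : seq nat := a.+1 :: nseq b 1%N.

Lemma hook_shape_part a b : is_intpart (hook_shape a b).
Proof.
apply/partP; split=> [[|i]|[|i]] //=; rewrite ?size_nseq ?ltnS !nth_nseq.
- by case: ifP.
- by do 2 case: ifP => //; lia.
- by move=> ->.
Qed.

Lemma sumn_hook_shape a b : sumn (hook_shape a b) = (a + b).+1.
Proof. by rewrite /= sumn_nseq mul1n. Qed.

Lemma nth_hook_shape a b i :
  nth 0%N (hook_shape a b) i = if i == 0%N then a.+1 else nat_of_bool (i <= b)%N.
Proof. by case: i => //= i; rewrite nth_nseq; case: ltnP. Qed.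

Lemma removable_hook_shape a b i : removable (hook_shape a b) i
  = (i == 0%N) && (0 < a)%N || (i == b).
Proof.
rewrite /removable !nth_hook_shape /=; case: i => [|i] /=.
  by case: b => [|b]; rewrite /= ?orbT ?orbF.
by rewrite eqn_leq; do 2 case: leqP; lia.
Qed.

Lemma decr_hook_shape_arm a b : decr_part (hook_shape a.+1 b) 0 = hook_shape a b.
Proof. by []. Qed.

Lemma decr_hook_shape_leg a b : decr_part (hook_shape a b.+1) b.+1 = hook_shape a b.
Proof.
rewrite /decr_part nth_hook_shape leqnn /= /hook_shape; congr (_ :: _).
by rewrite -[_ :: _]/(nseq b.+1 1%N) take_nseq.
Qed.

(** Branching is Pascal's rule: the largest entry ends the arm or the leg. *)
Lemma num_SYT_hook_shape a b : num_SYT (hook_shape a b) = 'C(a + b, b).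
Proof.
elim: a b => [|a IHa] b.
  elim: b => [|b IHb].
    rewrite (num_SYT_branch _ 0 (hook_shape_part _ _)) ?sumn_hook_shape //.
    by rewrite big_mkcond big_ord1 /= num_SYT_nil.
  rewrite (num_SYT_branch _ b.+1 (hook_shape_part _ _)) ?sumn_hook_shape //.
  rewrite (big_pred1 ord_max) /= => [|i].
    by rewrite decr_hook_shape_leg IHb !add0n !binn.
  by rewrite removable_hook_shape /= andbF /= -val_eqE.
elim: b => [|b IHb].
  rewrite (num_SYT_branch _ (a.+1 + 0) (hook_shape_part _ _)) ?sumn_hook_shape //.
  rewrite (big_pred1 ord0) /= => [|i].
    by rewrite decr_hook_shape_arm IHa !bin0.
  by rewrite removable_hook_shape /= andbT orbb -val_eqE.
rewrite (num_SYT_branch _ (a.+1 + b.+1) (hook_shape_part _ _)) ?sumn_hook_shape //.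
have bl : (b.+1 < (a.+1 + b.+1).+1)%N by lia.
rewrite (bigD1 ord0) /= ?removable_hook_shape // (bigD1 (Ordinal bl)) /=; last first.
  by rewrite removable_hook_shape eqxx orbT.
rewrite big_pred0 => [|i]; last first.
  rewrite removable_hook_shape -!val_eqE /= andbT.
  by do 2 case: eqP => //.
rewrite decr_hook_shape_arm decr_hook_shape_leg IHa IHb addn0.
by rewrite (addSnnS a b) [(a.+1 + b.+1)%N]addSn binS.
Qed.

(** The first row and first column share one cell, so the total [n.+2] means that they exhaust the
    diagram. *)
Lemma hook_shapeP n (la : intpart n.+1) :
  (nth 0 la 0 + size la == n.+2)%N = (val la == hook_shape (n.+1 - size la) (size la).-1).
Proof.
case: la => la laP /=; have /andP[/andP[_ n0] /eqP sla] := laP.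
case: la n0 sla {laP} => [|a mu] //=; rewrite inE negb_or eq_sym -lt0n => /andP[a0 n0] sla.
rewrite /hook_shape eqseq_cons addnS eqSS.
have szmu := size_le_sumn _ n0.
have -> : (a == (n.+1 - (size mu).+1).+1) && (mu == nseq (size mu) 1%N)
   = (mu == nseq (size mu) 1%N).
  case: (mu =P nseq (size mu) 1%N) => [e|_]; last by rewrite andbF.
  rewrite andbT; apply/eqP; have := congr1 sumn e; rewrite sumn_nseq mul1n; lia.
transitivity (sumn mu == size mu); first by rewrite -sla -[in RHS](eqn_add2l a) eq_sym.
apply/eqP/eqP => [|e]; last by rewrite e sumn_nseq size_nseq mul1n.
elim: mu n0 {sla szmu} => //= q s IHs; rewrite inE negb_or eq_sym -lt0n => /andP[q0 s0] e.
have szs := size_le_sumn _ s0.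
by rewrite -IHs //; [congr (_ :: _); lia | lia].
Qed.

Lemma hook_sum_top r (la : intpart r.+1) :
  hook_sum (horner (hook_poly r)) la
  = if (nth 0 la 0 + size la == r.+2)%N then (hook_poly r).[r.+1%:R] else 0.
Proof.
have /andP[pla /eqP sla] := valP la.
have h0 : (0 < nth 0 la 0)%N.
  have /partP[_ pos] := pla; apply: pos; rewrite lt0n; apply/negP => /nilP e.
  by rewrite e in sla.
have [u [u1 u2]] := cell_ex _ _ _ h0.
have hu : (hook_length u).+1 = (nth 0 la 0 + size la)%N.
  have /partP[_ pos] := pla.
  have : conj_part la 0 = size la.
    by apply/eqP; rewrite -all_count; apply/(all_nthP 0%N) => i /pos.
  have := crow_lt _ u.
  by rewrite /hook_length u1 u2 => h ->; lia.
rewrite /hook_sum (bigD1 u) //= big1 => [|v vu]; last first.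
  apply: hook_poly_root; rewrite hook_length_gt0 /=.
  have := hook_length_le _ v pla; rewrite sla => h.
  suff : (0 < crow v + ccol v)%N by lia.
  rewrite lt0n; apply: contraNneq vu => e; apply/eqP; apply: cell_inj; lia.
rewrite addr0 -hu eqSS; case: eqP => [-> //|ne]; apply: hook_poly_root.
rewrite hook_length_gt0 /=; have := hook_length_le _ u pla; rewrite sla; lia.
Qed.

Lemma hook_avg_top r : plancherel r.+1 (hook_sum (horner (hook_poly r)))
  = (r.+1)`!%:R^-1 * ('C(r.*2, r)%:R * (hook_poly r).[r.+1%:R]).
Proof.
rewrite /plancherel; congr (_ * _).
pose K := (hook_poly r).[r.+1%:R].
rewrite (eq_bigr (fun la : intpart r.+1 => if (nth 0 la 0 + size la == r.+2)%N
   then (num_SYT la)%:R ^+ 2 * K else 0)); last first.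
  by move=> la _; rewrite hook_sum_top; case: ifP; rewrite // mulr0.
rewrite -big_mkcond /= -mulr_suml; congr (_ * _).
(* Shapes are sorted by their leg [b]; each value leaves the single hook with arm [r - b]. *)
rewrite (partition_big (fun la : intpart r.+1 => inord (size la).-1 : 'I_r.+1) xpredT) //=.
have vdmd : 'C(r.*2, r)%:R = \sum_(b < r.+1) 'C(r, b)%:R ^+ 2 :> rat.
  rewrite -addnn -binomial.Vandermonde natr_sum; apply: eq_bigr => b _.
  by rewrite natrM bin_sub // -ltnS.
rewrite vdmd; apply: eq_bigr => b _.
have br : (b <= r)%N by rewrite -ltnS.
rewrite (eq_bigl (fun la : intpart r.+1 => val la == hook_shape (r - b) b)); last first.
  move=> la; have /andP[pla /eqP sla] := valP la.
  have szl : (size la <= r.+1)%N by have := size_part_le _ pla; rewrite sla.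
  rewrite hook_shapeP -val_eqE /= inordK; last by lia.
  apply/andP/eqP => [[/eqP e /eqP sb]|e].
    rewrite e sb; congr hook_shape.
    have : (0 < size la)%N by rewrite e.
    lia.
  by rewrite e /= size_nseq eqxx subSS.
rewrite (sum_intpart1 _ _ (fun la => (num_SYT la)%:R ^+ 2)) hook_shape_part.
rewrite sumn_hook_shape subnK // eqxx /= num_SYT_hook_shape subnK //.
Qed.

(** Each factor splits as (r + 1 - i)(r + 1 + i), so the product is r! (2 r + 1)! / (r + 1)!; [key]
    is its partial form with denominators cleared. *)
Lemma hook_poly_top r :
  2 * r.+1%:R ^+ 2 * (hook_poly r).[r.+1%:R] = (r.*2.+2)`!%:R.
Proof.
have key k : (k <= r)%N ->
  \prod_(1 <= i < k.+1) (r.+1%:R ^+ 2 - i%:R ^+ 2) * ((r - k)`! * (r.+1)`!)%N%:R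
  = (r`! * (r.+1 + k)`!)%N%:R :> rat.
  elim: k => [|k IH] kr; first by rewrite big_geq // subn0 addn0 mul1r.
  rewrite big_nat_recr //= addnS [in RHS]factS [in RHS]mulnCA [in RHS]natrM.
  rewrite -IH; last exact: ltnW.
  have -> : (r - k = (r - k.+1).+1)%N by lia.
  have E : (r - k.+1).+1%:R = r.+1%:R - k.+1%:R :> rat.
    by rewrite -natrB; [congr (_%:R); lia | lia].
  have E' : (r.+1 + k).+1%:R = r.+1%:R + k.+1%:R :> rat by rewrite -natrD addnS.
  by rewrite factS !natrM E E'; ring.
have := key r (leqnn r); rewrite subnn mul1n -hook_polyE => e.
have f0 : (r.+1)`!%:R != 0 :> rat by rewrite pnatr_eq0 -lt0n fact_gt0.
apply: (mulIf f0); rewrite -[LHS]mulrA e.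
have -> : (r.+1 + r = r.*2.+1)%N by lia.
rewrite [(r.*2.+2)`!]factS [(r.+1)`!]factS !natrM.
have -> : r.*2.+2%:R = 2 * r.+1%:R :> rat by rewrite -natrM; congr (_%:R); lia.
ring.
Qed.

Lemma prod_falling n k : \prod_(0 <= j < k) (n%:R - j%:R) = (n ^_ k)%:R :> rat.
Proof.
elim: k => [|k IH]; first by rewrite big_geq.
rewrite big_nat_recr //= IH ffactnSr natrM.
case: (leqP k n) => kn; first by rewrite natrB.
by rewrite ffact_small // !mul0r.
Qed.

Theorem theorem1 (n r : nat) (hn : (1 <= n)%N) :
  1 / (n`!)%:R *
    (\sum_(la : intpart n) (num_SYT la)%:R ^+ 2 *
       \sum_(u : cell la)
          \prod_(1 <= i < r.+1) ((hook_length u)%:R ^+ 2 - i%:R ^+ 2))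
  = 1 / (2 * (r%:R + 1) ^+ 2) * ('C(2 * r, r))%:R * ('C(2 * r + 2, r + 1))%:R *
      \prod_(0 <= j < r.+1) (n%:R - j%:R) :> rat.
Proof.
transitivity (plancherel n (hook_sum (horner (hook_poly r)))).
  rewrite /plancherel div1r; congr (_ * _); apply: eq_bigr => la _; congr (_ * _).
  by apply: eq_bigr => u _; rewrite hook_polyE.
rewrite (ddeg_interp r.+1 _ (hook_avg_ddeg r) (hook_avg_small r)) hook_avg_top.
rewrite prod_falling -bin_ffact natrM natr1 mul2n addn2 addn1.
(* Writing (2 r + 2)! as C(2 r + 2, r + 1) (r + 1)!^2 determines the polynomial's value. One
   factorial cancels the Plancherel normalization, the other turns C(n, r + 1) into the falling
   product. *)
have := bin_fact (leq_addl r.+1 r.+1); rewrite addnK addnn doubleS.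
move=> /(congr1 (fun k => k%:R : rat)); rewrite -hook_poly_top 2!natrM.
have f0 : (r.+1)`!%:R != 0 :> rat by rewrite pnatr_eq0 -lt0n fact_gt0.
have r0 : r.+1%:R != 0 :> rat by rewrite pnatr_eq0.
move: f0 r0; move: ((r.+1)`!%:R : rat) (r.+1%:R : rat) => f s f0 s0.
set K := _.[_]; set c := 'C(_, _)%:R; set b := 'C(_, _)%:R; set d := 'C(_, _)%:R => e.
have -> : K = c * (f * f) / (2 * s ^+ 2) by rewrite e; field.
by field; rewrite f0 s0.
Qed.
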